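(* Let $F_2$ be a nonempty finite set of positive integers, $\mathcal F=(\emptyset,F_2)$, and let $\alpha,\beta$ be real numbers satisfying (A1) and (A2) such that $\alpha,\beta,\mathcal F$ are Jacobi admissible. Then $\alpha+k_2+1>0$, $\beta-k_2+1>0$ and $\Omega^{\alpha,\beta}_{\mathcal F}(x)\neq0$ for all $x\in[-1,1]$.
   Context: $(a)_0=1$, $(a)_j=a(a+1)\cdots(a+j-1)$. Jacobi polynomials: $P^{a,b}_n(x)=2^{-n}\sum_{j=0}^n\binom{n+a}{j}\binom{n+b}{n-j}(x-1)^{n-j}(x+1)^j$. $F_2=\{f^{(2)}_1<\dots<f^{(2)}_{k_2}\}$, $k=k_2$ here. (A1): $\alpha,\beta,\alpha+\beta\notin\{-1,-2,\dots\}$. (A2): $\alpha-\beta\notin\{-1,-2,\dots\}$ and $\beta-f^{(2)}_{k_2}-1\notin\{-1,-2,\dots\}$. For $\mathcal F=(\emptyset,F_2)$: $\Omega^{\alpha,\beta}_{\mathcal F}(x)=\det W(x)/(1+x)^{k_2(k_2-1)}$, with $W(x)$ the $k_2\times k_2$ matrix with columns $j=1,\dots,k_2$ and rows, for $f\in F_2$ increasing, $\big((\beta-f)_{j-1}(1+x)^{k_2-j}P^{\alpha+j-1,-\beta-j+1}_f(x)\big)_j$. Jacobi admissibility: with $\mathcal H^{\alpha,\beta}_{\mathcal F}(x)=\prod_{f\in F_2}(x+\beta-f)(x+f+\alpha+1)\cdot\frac{\Gamma(x+\alpha+1)\Gamma(x+\beta+1)}{(2x+\alpha+\beta+1)\Gamma(x+\alpha+\beta+1)}$,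 $\alpha,\beta,\mathcal F$ are Jacobi admissible if $\mathcal H^{\alpha,\beta}_{\mathcal F}(x)\ge0$ for all $x\in\mathbb N=\{0,1,2,\dots\}$. *)

(* Defs.v *)
From Stdlib Require Import Arith Factorial Reals Lra Lia List Sorted ClassicalEpsilon.
Open Scope R_scope.

Fixpoint prodR (n : nat) (f : nat -> R) : R :=
  match n with O => 1 | S m => prodR m f * f m end.

Fixpoint sumR (n : nat) (f : nat -> R) : R :=
  match n with O => 0 | S m => sumR m f + f m end.

Definition poch (a : R) (j : nat) : R := prodR j (fun i => a + INR i).

Definition gbinom (y : R) (j : nat) : R :=
  prodR j (fun i => y - INR i) / INR (fact j).

Definition jacobiP (a b : R) (n : nat) (x : R) : R :=
  / 2 ^ n * sumR (S n) (fun j =>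
     gbinom (INR n + a) j * gbinom (INR n + b) (n - j)
     * (x - 1) ^ (n - j) * (x + 1) ^ j).

Fixpoint detR (n : nat) (M : nat -> nat -> R) : R :=
  match n with
  | O => 1
  | S m => sumR (S m) (fun j =>
      (-1) ^ j * M 0%nat j *
      detR m (fun r c => M (S r) (if Nat.ltb c j then c else S c)))
  end.

(* the matrix W(x) for F = (emptyset, F2), F2 listed increasingly;
   row r <-> f = r-th element of F2, column c (0-based) <-> j = c+1 *)
Definition Wmat (a b : R) (F2 : list nat) (x : R) (r c : nat) : R :=
  let k := length F2 in
  let f := nth r F2 0%nat in
  poch (b - INR f) c * (1 + x) ^ (k - 1 - c)
  * jacobiP (a + INR c) (- b - INR c) f x.

(* det W(x) / (1+x)^{k(k-1)}, as a rational expression (defined for x <> -1) *)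
Definition OmegaRaw (a b : R) (F2 : list nat) (x : R) : R :=
  let k := length F2 in
  detR k (Wmat a b F2 x) / (1 + x) ^ (k * (k - 1)).

(* Euler's Gamma function via Euler's limit formula
   Gamma(z) = lim_n n! n^z / (z (z+1) ... (z+n))  (z not in {0,-1,-2,...}) *)
Definition gamma_seq (z : R) (n : nat) : R :=
  INR (fact n) * Rpower (INR n) z / prodR (S n) (fun i => z + INR i).

Definition Gamma (z : R) : R :=
  epsilon (inhabits 0) (fun l => Un_cv (gamma_seq z) l).

Definition Hfun (a b : R) (F2 : list nat) (x : R) : R :=
  fold_right (fun f acc => (x + b - INR f) * (x + INR f + a + 1) * acc) 1 F2
  * (Gamma (x + a + 1) * Gamma (x + b + 1)
     / ((2 * x + a + b + 1) * Gamma (x + a + b + 1))).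

Definition jacobi_admissible (a b : R) (F2 : list nat) : Prop :=
  forall n : nat, 0 <= Hfun a b F2 (INR n).

Definition not_neg_int (y : R) : Prop := forall n : nat, y <> - INR (S n).

Definition condA1 (a b : R) : Prop :=
  not_neg_int a /\ not_neg_int b /\ not_neg_int (a + b).

Definition condA2 (a b : R) (F2 : list nat) : Prop :=
  not_neg_int (a - b) /\ not_neg_int (b - INR (last F2 0%nat) - 1).

Definition valid_F2 (F2 : list nat) : Prop :=
  F2 <> nil /\ StronglySorted lt F2 /\ Forall (fun f => (0 < f)%nat) F2.

(* Main.v *)
Require Import Defs.
From Stdlib Require Import Reals List.
From Stdlib Require Import Arith Factorial Ranalysis5 Sorted Permutation ZArith FinFun.
From Stdlib Require Import Lra Lia Psatz Classical ClassicalEpsilon.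
From mathcomp Require ssreflect ssrfun ssrbool eqtype ssrnat seq fintype bigop.
From mathcomp Require ssralg matrix mxalgebra Rstruct.
Import ListNotations.
Open Scope R_scope.

(* Up to sign, Omega is the Wronskian of the Jacobi polynomials p_f = P_f^(a, -b),
   f in F2.  They solve (1 - x^2) y'' + B y' + Lam_f y = 0 with
   Lam_f = f (f + a - b + 1), and a Darboux transformation
   y_f |-> y_f' - (y_g' / y_g) y_f leads to an equation of the same shape with a
   raised by one and b lowered by one.  A combination of the p_f vanishing to order
   k = |F2| at a point is killed by successive transformations, so it is enough to
   order F2 in such a way that every function y_g used on the way has no zero
   on [-1, 1].

   If v is the transform of y_f by y_g after n steps, then
   (1 - x^2) v' + t v = (Lam_g - Lam_f) y_f.  When y_f has no zero and
   a + 1 + n > 0, this equation at the last zero of v excludes zeros.  When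
   Lam_f < Lam_g and v(-1), v(1) have the same sign, the maximum principle applied
   to y_f / y_g, whose derivative is v / y_g, excludes them.

   Let -m-1 < a < -m (or m = 0 if a > -1) and M-1 <= b < M.  Comparing the signs of
   H(n) and H(n+1) shows that F2 has exactly one element in each pair
   {i, M+m-1-i}, i < m, and that its other elements lie in [m, M-1].  The pairs are
   used first, from the outside in, by the second criterion, which also allows one
   element of [m, M-1]; the first criterion then takes care of the rest. *)

(** * Zeros of solutions of linear differential equations *)

(** What fixes the order is a parity count. Put c = -b. At -1 and 1 the first-order relation is
    algebraic, and it makes v(-1) v(1) equal to y_f(-1) y_f(1) times -(Lam_g - Lam_f)^2 / (4 (a+1+n)
    (c+1+n)). For n < m and n + 1 < M both a+1+n and c+1+n are negative, so each such step reverses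
    the sign of the product of the end values. For p_f itself this sign is (-1)^[end_sign], whose
    exponent has the parity of i on the pair {i, M+m-1-i} and equals m on [m, M-1]. After exactly i,
    respectively m, steps the product is therefore positive, as the second criterion demands; a p_f
    with odd [end_sign] has a zero in [-1, 1] and cannot be used first. The other demand, Lam_f <
    Lam_g, is met by going inwards because, for m > 0, Lam is a parabola in f with its vertex within
    1/2 of (M+m-1)/2. The first function of a nonempty family of pairs has no predecessor to be
    compared with. It is the polynomial of degree M+m-1, since 0 is not in F2, and it gets a
    criterion of its own. *)

Lemma pos_or_neg (y : R) : y <> 0 -> 0 < y \/ 0 < - y.
Proof. intros; lra. Qed.

Lemma derivable_pt_lim_eq f x l l' :
  derivable_pt_lim f x l -> l = l' -> derivable_pt_lim f x l'.
Proof. intros H <-; exact H. Qed.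

Lemma derivable_pt_lim_continuity f x l :
  derivable_pt_lim f x l -> continuity_pt f x.
Proof. intros H; apply derivable_continuous_pt; exists l; exact H. Qed.

Lemma increasing_at f x l :
  derivable_pt_lim f x l -> 0 < l ->
  exists e, 0 < e /\ forall h, 0 < h < e -> f (x - h) < f x < f (x + h).
Proof.
intros H l0; destruct (H (l / 2)) as [e He]; [lra|].
exists e; split; [apply cond_pos|]; intros h h0.
assert (Q : forall u, u <> 0 -> Rabs u < e -> 0 < (f (x + u) - f x) / u).
{ intros u u0 ue; specialize (He u u0 ue).
  apply Rabs_def2 in He; lra. }
split.
- assert (P := Q (- h)); rewrite Rabs_Ropp, Rabs_pos_eq in P by lra.
  specialize (P ltac:(lra) ltac:(lra)).
  replace (x - h) with (x + - h) by ring.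
  assert (0 < (f (x + - h) - f x) / - h * h) by (apply Rmult_lt_0_compat; lra).
  replace ((f (x + - h) - f x) / - h * h) with (f x - f (x + - h)) in H0
    by (field; lra). lra.
- assert (P := Q h); rewrite Rabs_pos_eq in P by lra.
  specialize (P ltac:(lra) ltac:(lra)).
  assert (0 < (f (x + h) - f x) / h * h) by (apply Rmult_lt_0_compat; lra).
  replace ((f (x + h) - f x) / h * h) with (f (x + h) - f x) in H0
    by (field; lra). lra.
Qed.

Lemma continuity_pos_local f x :
  continuity_pt f x -> 0 < f x ->
  exists e, 0 < e /\ forall y, Rabs (y - x) < e -> 0 < f y.
Proof.
intros H fx; destruct (H (f x) fx) as [e [e0 He]].
exists e; split; [exact e0|]; intros y Hy.
destruct (Req_dec y x) as [->|n]; [exact fx|].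
assert (Q : R_dist (f y) (f x) < f x).
{ apply He; split; [split; [exact I|auto]|exact Hy]. }
unfold R_dist in Q; apply Rabs_def2 in Q; lra.
Qed.

Lemma nonvanishing_same_sign f a b :
  a <= b -> (forall x, a <= x <= b -> continuity_pt f x) ->
  (forall x, a <= x <= b -> f x <> 0) -> 0 < f a * f b.
Proof.
intros ab c n; destruct (Req_dec a b) as [<-|ne].
{ assert (f a <> 0) by (apply n; lra); nra. }
assert (na : f a <> 0) by (apply n; lra).
assert (nb : f b <> 0) by (apply n; lra).
destruct (pos_or_neg _ na), (pos_or_neg _ nb); [nra| | |nra].
- destruct (IVT_interv (- f)%F a b) as [z [z1 z2]]; unfold opp_fct in *; try lra.
  { intros; apply continuity_pt_opp, c; lra. }
  exfalso; apply (n z z1); lra.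
- destruct (IVT_interv f a b) as [z [z1 z2]]; try lra; try auto.
  exfalso; apply (n z z1); lra.
Qed.

Lemma last_zero f a b :
  a < b -> (forall x, a <= x <= b -> continuity_pt f x) -> 0 <= f a -> f b < 0 ->
  exists z, a <= z < b /\ f z = 0 /\ forall x, z < x <= b -> f x < 0.
Proof.
intros ab c fa fb.
destruct (completeness (fun x => a <= x <= b /\ 0 <= f x)) as [z [ub lub]].
{ exists b; intros x [Hx _]; lra. }
{ exists a; split; lra. }
assert (az : a <= z) by (apply ub; split; lra).
assert (zb : z <= b) by (apply lub; intros x [Hx _]; lra).
assert (neg : forall x, z < x <= b -> f x < 0).
{ intros x Hx; apply Rnot_le_lt; intros fx.
  assert (x <= z) by (apply ub; split; lra); lra. }
assert (f z <= 0).
{ apply Rnot_lt_le; intros fz.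
  destruct (continuity_pos_local f z (c z (conj az zb)) fz) as [e [e0 He]].
  assert (z <> b) by (intros ->; lra).
  set (y := Rmin (z + e / 2) b).
  assert (z < y <= b) by (unfold y; split; [apply Rmin_glb_lt; lra|apply Rmin_r]).
  assert (y <= z + e / 2) by apply Rmin_l.
  assert (0 < f y) by (apply He; rewrite Rabs_pos_eq; lra).
  assert (f y < 0) by (apply neg; lra); lra. }
assert (0 <= f z).
{ apply Rnot_lt_le; intros fz.
  destruct (continuity_pos_local (- f)%F z) as [e [e0 He]].
  { apply continuity_pt_opp, c; lra. }
  { unfold opp_fct; lra. }
  assert (z <= z - e / 2); [|lra].
  apply lub; intros x [Hx fx].
  apply Rnot_lt_le; intros Hxz.
  assert (x <= z) by (apply ub; split; auto).
  assert (Q := He x); unfold opp_fct in Q.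
  assert (0 < - f x); [apply Q; apply Rabs_def1; lra|lra]. }
exists z; repeat split; try lra; [|auto].
assert (z <> b) by (intros ->; lra); lra.
Qed.

(** At 1 the equation reads t(1) v(1) = rho(1), so v(1) and rho(1) have opposite signs. At the last
    zero z before 1 it gives (1 - z^2) v'(z) = rho(z), which has the sign of rho(1), so v would
    leave z with the wrong sign. The point -1, where the leading coefficient vanishes too, is left
    to the caller. *)
Lemma first_order_no_zero (t v v1 rho : R -> R) :
  (forall x, -1 <= x <= 1 -> derivable_pt_lim v x (v1 x)) ->
  (forall x, -1 <= x <= 1 -> (1 - x ^ 2) * v1 x + t x * v x = rho x) ->
  (forall x, -1 <= x <= 1 -> continuity_pt rho x) ->
  (forall x, -1 < x <= 1 -> rho x <> 0) -> t 1 < 0 ->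
  forall x, -1 < x <= 1 -> v x <> 0.
Proof.
intros dv ode c nz t1 x0 Hx0 vx0.
assert (n1 : rho 1 <> 0) by (apply nz; lra).
assert (pos : forall x, -1 < x <= 1 -> 0 < rho x * rho 1).
{ intros x Hx; apply nonvanishing_same_sign; [lra|intros; apply c; lra|].
  intros; apply nz; lra. }
assert (E1 := ode 1 ltac:(lra)).
assert (x0 <> 1). { intros ->. rewrite vx0 in E1; lra. }
set (u := fun x => rho 1 * v x).
assert (du : forall x, -1 <= x <= 1 -> derivable_pt_lim u x (rho 1 * v1 x)).
{ intros x Hx; apply derivable_pt_lim_scal, dv, Hx. }
assert (u1 : u 1 < 0).
{ unfold u; assert (t 1 * (rho 1 * v 1) > 0) by nra. nra. }
destruct (last_zero u x0 1) as [z [Hz [uz neg]]]; auto; try lra.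
{ intros x Hx; eapply derivable_pt_lim_continuity, du; lra. }
{ unfold u; rewrite vx0; lra. }
assert (vz : v z = 0). { unfold u in uz; apply Rmult_integral in uz; lra. }
assert (Ez := ode z ltac:(lra)); rewrite vz in Ez.
assert (pz := pos z ltac:(lra)).
assert (0 < rho 1 * v1 z).
{ rewrite <- Ez in pz. assert (0 < 1 - z ^ 2) by nra.
  apply Rmult_lt_reg_l with (1 - z ^ 2); lra. }
destruct (increasing_at u z _ (du z ltac:(lra)) H0) as [e [e0 He]].
set (h := Rmin (e / 2) (1 - z)).
assert (0 < h) by (apply Rmin_glb_lt; lra).
assert (h <= e / 2) by apply Rmin_l.
assert (h <= 1 - z) by apply Rmin_r.
destruct (He h ltac:(lra)) as [_ P].
assert (u (z + h) < 0) by (apply neg; lra). lra.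
Qed.

Lemma gronwall_zero E E1 K a b :
  (forall x, a <= x <= b -> derivable_pt_lim E x (E1 x)) ->
  (forall x, a <= x <= b -> E1 x <= K * E x) ->
  a < b -> E a = 0 -> E b <= 0.
Proof.
intros d le ab Ea.
destruct (MVT_cor2 (fun x => E x * exp (- K * x))
   (fun x => (E1 x - K * E x) * exp (- K * x)) a b ab) as [c [Hc cab]].
{ intros x Hx.
  eapply derivable_pt_lim_eq.
  { apply (derivable_pt_lim_mult E (fun x => exp (- K * x))); [apply d, Hx|].
    apply (derivable_pt_lim_comp (fun x => - K * x) exp).
    - apply derivable_pt_lim_scal, derivable_pt_lim_id.
    - apply derivable_pt_lim_exp. }
  ring. }
rewrite Ea in Hc.
assert (P := exp_pos (- K * c)); assert (P' := exp_pos (- K * b)).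
assert (L := le c ltac:(lra)).
assert (E b * exp (- K * b) <= 0).
{ assert ((E1 c - K * E c) * exp (- K * c) <= 0) by nra. nra. }
nra.
Qed.

Lemma interior_max_critical f f1 a b x :
  a < x < b -> derivable_pt_lim f x f1 ->
  (forall y, a <= y <= b -> f y <= f x) -> f1 = 0.
Proof.
intros Hx d mx; destruct (Req_dec f1 0) as [|n]; [auto|exfalso].
assert (P : exists e, 0 < e /\ forall h, 0 < h < e ->
   f x < f (x - h) \/ f x < f (x + h)).
{ destruct (pos_or_neg _ n) as [p|p].
  - destruct (increasing_at _ _ _ d p) as [e [e0 He]].
    exists e; split; [auto|]; intros h Hh; right; apply He, Hh.
  - destruct (increasing_at (- f)%F x (- f1)) as [e [e0 He]]; [|auto|].
    { apply derivable_pt_lim_opp, d. }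
    exists e; split; [auto|]; intros h Hh; left.
    destruct (He h Hh); unfold opp_fct in *; lra. }
destruct P as [e [e0 He]].
set (h := Rmin (e / 2) (Rmin (x - a) (b - x))).
assert (0 < h) by (repeat apply Rmin_glb_lt; lra).
assert (h <= e / 2) by apply Rmin_l.
assert (h <= Rmin (x - a) (b - x)) by apply Rmin_r.
assert (Rmin (x - a) (b - x) <= x - a) by apply Rmin_l.
assert (Rmin (x - a) (b - x) <= b - x) by apply Rmin_r.
destruct (He h ltac:(lra)).
- assert (f (x - h) <= f x) by (apply mx; lra); lra.
- assert (f (x + h) <= f x) by (apply mx; lra); lra.
Qed.

(* Left of a critical point with positive value, [r] would have an interior
   maximum with positive value, where the equation makes [r] convex. *)
Lemma critical_value_nonpos (T r w w1 : R -> R) (delta : R) :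
  0 < delta ->
  (forall x, -1 <= x <= 1 -> derivable_pt_lim r x (w x)) ->
  (forall x, -1 <= x <= 1 -> derivable_pt_lim w x (w1 x)) ->
  (forall x, -1 <= x <= 1 -> (1 - x ^ 2) * w1 x + T x * w x = delta * r x) ->
  0 < w (-1) ->
  forall x, -1 < x < 1 -> w x = 0 -> r x <= 0.
Proof.
intros d0 dr dw ode wm x Hx wx.
apply Rnot_lt_le; intros rx.
assert (conv : forall y, -1 < y < 1 -> w y = 0 -> 0 < r y -> 
   exists e, 0 < e /\ forall h, 0 < h < e -> r y < r (y - h)).
{ intros y Hy wy ry.
  assert (0 < w1 y).
  { assert (Ey := ode y ltac:(lra)); rewrite wy in Ey.
    assert (0 < 1 - y ^ 2) by nra.
    assert (0 < delta * r y) by (apply Rmult_lt_0_compat; lra).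
    apply Rmult_lt_reg_l with (1 - y ^ 2); lra. }
  destruct (increasing_at w y _ (dw y ltac:(lra)) H) as [e [e0 He]].
  exists (Rmin e (y + 1)); split; [apply Rmin_glb_lt; lra|].
  intros h Hh.
  assert (h < e) by (eapply Rlt_le_trans; [apply Hh|apply Rmin_l]).
  assert (h < y + 1) by (eapply Rlt_le_trans; [apply Hh|apply Rmin_r]).
  destruct (MVT_cor2 r w (y - h) y) as [c [Hc cy]]; [lra| |].
  { intros z Hz; apply dr; lra. }
  assert (w c < 0).
  { destruct (He (y - c) ltac:(lra)) as [Q _].
    replace (y - (y - c)) with c in Q by ring. lra. }
  nra. }
destruct (continuity_ab_maj r (-1) x) as [z [mx Hz]]; [lra| |].
{ intros y Hy; eapply derivable_pt_lim_continuity, dr; lra. }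
assert (rz : 0 < r z) by (assert (r x <= r z) by (apply mx; lra); lra).
assert (zm : z <> -1).
{ intros ->; destruct (increasing_at r (-1) _ (dr (-1) ltac:(lra)) wm) as [e [e0 He]].
  set (h := Rmin (e / 2) (x + 1)).
  assert (0 < h) by (apply Rmin_glb_lt; lra).
  assert (h <= e / 2) by apply Rmin_l.
  assert (h <= x + 1) by apply Rmin_r.
  destruct (He h ltac:(lra)) as [_ Q].
  assert (r (-1 + h) <= r (-1)) by (apply mx; lra); lra. }
assert (wz : w z = 0).
{ destruct (Req_dec z x) as [->|]; [auto|].
  apply (interior_max_critical r (w z) (-1) x z); [lra|apply dr; lra|auto]. }
destruct (conv z ltac:(lra) wz rz) as [e [e0 He]].
set (h := Rmin (e / 2) (z + 1)).
assert (0 < h) by (apply Rmin_glb_lt; lra).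
assert (h <= e / 2) by apply Rmin_l.
assert (h <= z + 1) by apply Rmin_r.
assert (Q := He h ltac:(lra)).
assert (r (z - h) <= r z) by (apply mx; lra); lra.
Qed.

Lemma derivable_pt_lim_reflect f x l :
  derivable_pt_lim f (- x) l -> derivable_pt_lim (fun y => f (- y)) x (- l).
Proof.
intros H; eapply derivable_pt_lim_eq.
{ apply (derivable_pt_lim_comp Ropp f); [|exact H].
  apply derivable_pt_lim_opp, derivable_pt_lim_id. }
ring.
Qed.

(** The difference of the two sides is delta (r - w)^2 + ((1 + t) w)^2 + r^2 + (t r)^2. *)
Lemma energy_bound delta r w t : 0 <= delta ->
  2 * w * (delta * r - t * w) <= (delta + 1 + t * t) * (r * r + w * w).
Proof.
intros d0.
assert (0 <= delta * ((r - w) * (r - w)))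
  by (apply Rmult_le_pos; [lra|apply Rle_0_sqr]).
assert (0 <= ((1 + t) * w) * ((1 + t) * w)) by apply Rle_0_sqr.
assert (0 <= r * r) by apply Rle_0_sqr.
assert (0 <= (t * r) * (t * r)) by apply Rle_0_sqr.
lra.
Qed.

(** A zero x of w is a critical point of r. The convexity argument gives r(x) <= 0 from the left end
    and r(x) >= 0 from the right end, so r and r' = w vanish together, and uniqueness contradicts
    w(1) > 0. *)
Lemma second_order_no_critical_pos (T r w w1 : R -> R) (delta : R) :
  0 < delta ->
  (forall x, -1 <= x <= 1 -> continuity_pt T x) ->
  (forall x, -1 <= x <= 1 -> derivable_pt_lim r x (w x)) ->
  (forall x, -1 <= x <= 1 -> derivable_pt_lim w x (w1 x)) ->
  (forall x, -1 <= x <= 1 -> (1 - x ^ 2) * w1 x + T x * w x = delta * r x) ->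
  0 < w (-1) -> 0 < w 1 ->
  forall x, -1 <= x <= 1 -> w x <> 0.
Proof.
intros d0 cT dr dw ode wm wp x Hx wx.
assert (x <> 1) by (intros ->; lra).
assert (x <> -1) by (intros ->; lra).
assert (r x <= 0).
{ apply (critical_value_nonpos T r w w1 delta); auto; lra. }
(* Reflection: -r(-y) and -T(-y) in place of r and T give an equation of the same form, in which
   w(-y) is still positive at both ends. *)
assert (0 <= r x).
{ assert (- r x <= 0); [|lra].
  apply Rle_trans with (- r (- - x)); [rewrite Ropp_involutive; lra|].
  apply (critical_value_nonpos (fun y => - T (- y)) (fun y => - r (- y))
     (fun y => w (- y)) (fun y => - w1 (- y)) delta); auto; try lra.
  - intros y Hy; eapply derivable_pt_lim_eq.
    { apply (derivable_pt_lim_opp (fun y => r (- y))), derivable_pt_lim_reflect, dr; lra. }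
    ring.
  - intros y Hy; apply derivable_pt_lim_reflect, dw; lra.
  - intros y Hy; assert (E := ode (- y) ltac:(lra)).
    replace ((- y) ^ 2) with (y ^ 2) in E by ring. nra.
  - replace (- -1) with 1 by ring. auto.
  - rewrite Ropp_involutive; auto. }
(* With [r x = w x = 0], uniqueness for the linear system satisfied by [(r, w)]
   forces [w] to vanish on [x, 1). *)
assert (rx : r x = 0) by lra.
assert (zero : forall b, x < b < 1 -> w b <= 0).
{ intros b Hb.
  (* A bound for the growth rate of r^2 + w^2: the summand 1 covers 2 r w, the other one covers 2 w
     w' by [energy_bound]. It blows up at 1, hence b < 1; continuity of w at 1 closes the gap. *)
  set (kap := fun y => 1 + (delta + 1 + T y * T y) * / (1 - y ^ 2)).
  assert (ck : forall y, x <= y <= b -> continuity_pt kap y).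
  { intros y Hy; unfold kap.
    assert (0 < 1 - y ^ 2) by nra.
    apply (continuity_pt_plus (fun _ => 1)
       (fun y => (delta + 1 + T y * T y) * / (1 - y ^ 2))); [apply continuity_pt_const; intros ? ?; auto|].
    apply (continuity_pt_mult (fun y => delta + 1 + T y * T y) (fun y => / (1 - y ^ 2))).
    - apply (continuity_pt_plus (fun _ => delta + 1) (fun y => T y * T y));
        [apply continuity_pt_const; intros ? ?; auto|].
      apply (continuity_pt_mult T T); apply cT; lra.
    - apply (continuity_pt_inv (fun y => 1 - y ^ 2)); [|lra].
      apply (continuity_pt_minus (fun _ => 1) (fun y => y ^ 2));
        [apply continuity_pt_const; intros ? ?; auto|].
      eapply derivable_pt_lim_continuity, derivable_pt_lim_pow. }
  destruct (continuity_ab_maj kap x b) as [z [mx _]]; [lra|auto|].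
  assert (Q : r b * r b + w b * w b <= 0).
  { apply (gronwall_zero (fun y => r y * r y + w y * w y)
      (fun y => (w y * r y + r y * w y) + (w1 y * w y + w y * w1 y)) (kap z) x b);
      [| |lra|rewrite rx, wx; ring].
    - intros y Hy. apply (derivable_pt_lim_plus (fun y => r y * r y) (fun y => w y * w y)).
      + apply (derivable_pt_lim_mult r r); apply dr; lra.
      + apply (derivable_pt_lim_mult w w); apply dw; lra.
    - intros y Hy.
      apply Rle_trans with (kap y * (r y * r y + w y * w y)).
      2: { apply Rmult_le_compat_r; [nra|apply mx, Hy]. }
      assert (Ay : 0 < 1 - y ^ 2) by nra.
      assert (W : w1 y = (delta * r y - T y * w y) * / (1 - y ^ 2)).
      { rewrite <- (ode y) by lra. field. lra. }
      assert (Ai := Rinv_0_lt_compat _ Ay).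
      unfold kap; rewrite W; set (i := / (1 - y ^ 2)) in *.
      assert (Q := energy_bound delta (r y) (w y) (T y) ltac:(lra)).
      assert (Q' := Rle_0_sqr (r y - w y)); unfold Rsqr in Q'.
      apply (Rmult_le_compat_l i) in Q; lra. }
  nra. }
destruct (continuity_pos_local w 1) as [e [e0 He]]; [|auto|].
{ eapply derivable_pt_lim_continuity, dw; lra. }
set (h := Rmin (e / 2) ((1 - x) / 2)).
assert (0 < h) by (apply Rmin_glb_lt; lra).
assert (h <= e / 2) by apply Rmin_l.
assert (h <= (1 - x) / 2) by apply Rmin_r.
assert (w (1 - h) <= 0) by (apply zero; lra).
assert (0 < w (1 - h)); [|lra].
apply He; apply Rabs_def1; lra.
Qed.

Lemma second_order_no_critical (T r w w1 : R -> R) (delta : R) :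
  0 < delta ->
  (forall x, -1 <= x <= 1 -> continuity_pt T x) ->
  (forall x, -1 <= x <= 1 -> derivable_pt_lim r x (w x)) ->
  (forall x, -1 <= x <= 1 -> derivable_pt_lim w x (w1 x)) ->
  (forall x, -1 <= x <= 1 -> (1 - x ^ 2) * w1 x + T x * w x = delta * r x) ->
  0 < w (-1) * w 1 ->
  forall x, -1 <= x <= 1 -> w x <> 0.
Proof.
intros d0 cT dr dw ode p x Hx wx.
set (k := w 1).
assert (k <> 0) by (intros E; unfold k in E; rewrite E in p; lra).
apply (second_order_no_critical_pos T (fun y => k * r y) (fun y => k * w y)
  (fun y => k * w1 y) delta) with (x := x); auto.
- intros y Hy; apply derivable_pt_lim_scal; auto.
- intros y Hy; apply derivable_pt_lim_scal; auto.
- intros y Hy; rewrite <- (Rmult_assoc delta), (Rmult_comm delta), Rmult_assoc, <- (ode y Hy). ring.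
- unfold k; lra.
- unfold k in *; nra.
- rewrite wx; ring.
Qed.

(** A two-sided derivative is determined by increments of one sign, so agreement on [-1, 1] suffices
    even at the end points. Identities between transforms are known only there, where the
    denominators do not vanish. *)
Lemma derivative_ext_on f g x l l' :
  (forall y, -1 <= y <= 1 -> f y = g y) -> -1 <= x <= 1 ->
  derivable_pt_lim f x l -> derivable_pt_lim g x l' -> l = l'.
Proof.
intros fg Hx df dg.
assert (d : derivable_pt_lim (fun y => f y - g y) x (l - l'))
  by (apply derivable_pt_lim_minus; auto).
destruct (Req_dec l l') as [|n]; [auto|exfalso].
destruct (d (Rabs (l - l'))) as [e He]; [apply Rabs_pos_lt; lra|].
assert (Q : exists h, h <> 0 /\ Rabs h < e /\ -1 <= x + h <= 1).
{ assert (e0 := cond_pos e).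
  destruct (Rle_lt_dec x 0).
  - exists (Rmin (e / 2) 1); assert (Rmin (e / 2) 1 <= e / 2) by apply Rmin_l.
    assert (Rmin (e / 2) 1 <= 1) by apply Rmin_r.
    assert (0 < Rmin (e / 2) 1) by (apply Rmin_glb_lt; lra).
    rewrite Rabs_pos_eq by lra; repeat split; lra.
  - exists (- Rmin (e / 2) 1); assert (Rmin (e / 2) 1 <= e / 2) by apply Rmin_l.
    assert (Rmin (e / 2) 1 <= 1) by apply Rmin_r.
    assert (0 < Rmin (e / 2) 1) by (apply Rmin_glb_lt; lra).
    rewrite Rabs_Ropp, Rabs_pos_eq by lra; repeat split; lra. }
destruct Q as [h [h0 [he hI]]].
specialize (He h h0 he); simpl in He; rewrite (fg _ hI), (fg _ Hx) in He.
replace ((g (x + h) - g (x + h) - (g x - g x)) / h - (l - l')) with (- (l - l')) in He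
  by (field; auto).
rewrite Rabs_Ropp in He; lra.
Qed.

(** * Jacobi polynomials *)

Lemma sumR_ext n f g : (forall i, (i < n)%nat -> f i = g i) -> sumR n f = sumR n g.
Proof.
induction n; simpl; intros H; [auto|].
rewrite IHn by (intros; apply H; lia); rewrite H by lia; auto.
Qed.

Lemma sumR_plus n f g : sumR n (fun i => f i + g i) = sumR n f + sumR n g.
Proof. induction n; simpl; [ring|rewrite IHn; ring]. Qed.

Lemma sumR_scal n c f : sumR n (fun i => c * f i) = c * sumR n f.
Proof. induction n; simpl; [ring|rewrite IHn; ring]. Qed.

Lemma sumR_shift n f : sumR (S n) f = f 0%nat + sumR n (fun i => f (S i)).
Proof.
induction n; [simpl; ring|].
change (sumR (S (S n)) f) with (sumR (S n) f + f (S n)).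
rewrite IHn; simpl; ring.
Qed.

Lemma prodR_ext n f g : (forall i, (i < n)%nat -> f i = g i) -> prodR n f = prodR n g.
Proof.
induction n; simpl; intros H; [auto|].
rewrite IHn by (intros; apply H; lia); rewrite H by lia; auto.
Qed.

Lemma prodR_shift n f : prodR (S n) f = f 0%nat * prodR n (fun i => f (S i)).
Proof.
induction n; [simpl; ring|].
change (prodR (S (S n)) f) with (prodR (S n) f * f (S n)).
rewrite IHn; simpl; ring.
Qed.

Lemma INR_fact_pos n : 0 < INR (fact n).
Proof. apply lt_0_INR, lt_O_fact. Qed.

Lemma gbinom_0 y : gbinom y 0 = 1.
Proof. unfold gbinom; simpl; field. Qed.

Lemma gbinom_S y j : INR (S j) * gbinom y (S j) = (y - INR j) * gbinom y j.
Proof.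
unfold gbinom. change (fact (S j)) with (S j * fact j)%nat.
rewrite mult_INR; simpl prodR.
field; split; first [apply INR_fact_neq_0|apply not_0_INR; discriminate].
Qed.

Lemma gbinom_pred y j : INR (S j) * gbinom y (S j) = y * gbinom (y - 1) j.
Proof.
unfold gbinom. change (fact (S j)) with (S j * fact j)%nat.
rewrite mult_INR, prodR_shift.
rewrite (prodR_ext j (fun i => y - INR (S i)) (fun i => y - 1 - INR i))
  by (intros; rewrite S_INR; ring).
change (INR 0) with 0.
field; split; first [apply INR_fact_neq_0|apply not_0_INR; discriminate].
Qed.

Lemma gbinom_pascal y j : gbinom (y + 1) (S j) = gbinom y (S j) + gbinom y j.
Proof.
assert (n := not_0_INR (S j) ltac:(discriminate)).
apply Rmult_eq_reg_l with (INR (S j)); [|auto].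
rewrite gbinom_pred, Rmult_plus_distr_l, gbinom_S.
replace (y + 1 - 1) with y by ring. rewrite S_INR; ring.
Qed.

Lemma gbinom_absorb y j : (y - INR j) * gbinom y j = y * gbinom (y - 1) j.
Proof. rewrite <- gbinom_S; apply gbinom_pred. Qed.

Definition jacobi_coef (a b : R) (n j : nat) : R :=
  gbinom (INR n + a) j * gbinom (INR n + b) (n - j).

Definition jacobi_deriv (a b : R) (n : nat) (x : R) : R :=
  / 2 ^ n * sumR (S n) (fun j => jacobi_coef a b n j *
    (INR (n - j) * (x - 1) ^ pred (n - j) * (x + 1) ^ j +
     (x - 1) ^ (n - j) * (INR j * (x + 1) ^ pred j))).

Lemma derivable_pt_lim_sumR n F F1 x :
  (forall i, (i < n)%nat -> derivable_pt_lim (F i) x (F1 i)) ->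
  derivable_pt_lim (fun y => sumR n (fun i => F i y)) x (sumR n F1).
Proof.
induction n; simpl; intros H; [apply derivable_pt_lim_const|].
apply (derivable_pt_lim_plus (fun y => sumR n (fun i => F i y)) (F n));
  [apply IHn; intros; apply H; lia|apply H; lia].
Qed.

Lemma derivable_pt_lim_shift_pow c m x :
  derivable_pt_lim (fun y => (y + c) ^ m) x (INR m * (x + c) ^ pred m).
Proof.
eapply derivable_pt_lim_eq.
{ apply (derivable_pt_lim_comp (fun y => y + c) (fun y => y ^ m)).
  - apply (derivable_pt_lim_plus id (fun _ => c));
      [apply derivable_pt_lim_id|apply derivable_pt_lim_const].
  - apply derivable_pt_lim_pow. }
ring.
Qed.

Lemma derivable_jacobiP a b n x :
  derivable_pt_lim (jacobiP a b n) x (jacobi_deriv a b n x).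
Proof.
unfold jacobiP, jacobi_deriv.
apply (derivable_pt_lim_scal (fun x => sumR (S n) (fun j => _))).
apply derivable_pt_lim_sumR; intros i Hi.
eapply derivable_pt_lim_eq.
{ apply (derivable_pt_lim_mult
   (fun y => gbinom (INR n + a) i * gbinom (INR n + b) (n - i) * (y - 1) ^ (n - i))
   (fun y => (y + 1) ^ i)).
  - apply derivable_pt_lim_scal, (derivable_pt_lim_shift_pow (-1)).
  - apply derivable_pt_lim_shift_pow. }
unfold jacobi_coef; replace (x + -1) with (x - 1) by ring; ring.
Qed.

(** In the basis e_j = (x-1)^(n-j) (x+1)^j one has (x+1) e_j' = j e_j + (n-j) e_(j+1). The identity
    is thus a comparison of coefficients, settled by Pascal's rule and absorption. *)
Lemma jacobi_lower_b a b n x :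
  (x + 1) * jacobi_deriv a b n x + b * jacobiP a b n x =
  (INR n + b) * jacobiP (a + 1) (b - 1) n x.
Proof.
unfold jacobiP, jacobi_deriv.
fold (jacobi_coef a b n).
set (e := fun j => (x - 1) ^ (n - j) * (x + 1) ^ j).
transitivity (/ 2 ^ n * (sumR (S n) (fun j => (INR j + b) * jacobi_coef a b n j * e j)
   + sumR n (fun j => INR (n - j) * jacobi_coef a b n j * e (S j)))).
{ replace (sumR n (fun j => INR (n - j) * jacobi_coef a b n j * e (S j))) with
    (sumR (S n) (fun j => INR (n - j) * jacobi_coef a b n j * e (S j)))
    by (simpl; rewrite Nat.sub_diag; simpl; ring).
  rewrite <- sumR_plus.
  match goal with |- _ * (?i * ?S1) + _ * (?i * ?S2) = _ =>
    transitivity (i * ((x + 1) * S1 + b * S2)); [ring|] end.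
  f_equal.
  rewrite <- !sumR_scal, <- sumR_plus.
  apply sumR_ext; intros j Hj; unfold e, jacobi_coef.
  assert (E1 : INR (n - j) * (x - 1) ^ (n - S j) = INR (n - j) * (x - 1) ^ pred (n - j)).
  { do 2 f_equal; lia. }
  assert (E2 : INR j * (x + 1) ^ pred j * (x + 1) = INR j * (x + 1) ^ j).
  { destruct j; simpl; ring. }
  simpl ((x + 1) ^ S j).
  set (G := gbinom (INR n + a) j * gbinom (INR n + b) (n - j)).
  transitivity (G * (INR (n - j) * (x - 1) ^ pred (n - j)) * (x + 1) ^ j * (x + 1)
     + G * (x - 1) ^ (n - j) * (INR j * (x + 1) ^ pred j * (x + 1))
     + b * G * (x - 1) ^ (n - j) * (x + 1) ^ j).
  { unfold G; ring. }
  rewrite E2, <- E1; unfold G; ring. }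
rewrite <- Rmult_assoc, (Rmult_comm (INR n + b)), Rmult_assoc; f_equal.
rewrite <- sumR_scal, !sumR_shift, Rplus_assoc, <- sumR_plus; f_equal.
{ unfold e, jacobi_coef; rewrite Nat.sub_0_r, !gbinom_0; simpl INR.
  replace (INR n + (b - 1)) with (INR n + b - 1) by ring.
  assert (E := gbinom_absorb (INR n + b) n).
  replace (INR n + b - INR n) with b in E by ring.
  simpl pow; transitivity (b * gbinom (INR n + b) n * (x - 1) ^ n); [ring|].
  rewrite E; ring. }
apply sumR_ext; intros j Hj; unfold e, jacobi_coef.
destruct (n - j)%nat as [|m] eqn:Em; [lia|].
replace (n - S j)%nat with m by lia.
replace (INR n + (b - 1)) with (INR n + b - 1) by ring.
replace (INR n + (a + 1)) with (INR n + a + 1) by ring.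
rewrite gbinom_pascal.
assert (E1 := gbinom_pred (INR n + b) m).
assert (E2 := gbinom_absorb (INR n + b) m).
assert (E3 : INR n = INR j + 1 + INR m).
{ rewrite <- S_INR, <- plus_INR; f_equal; lia. }
replace (INR n + b - INR m) with (INR (S j) + b) in E2 by (rewrite E3, S_INR; ring).
set (X := (x - 1) ^ m * (x + 1) ^ S j).
transitivity (((INR (S j) + b) * gbinom (INR n + b) m) * gbinom (INR n + a) (S j) * X +
 (INR (S m) * gbinom (INR n + b) (S m)) * gbinom (INR n + a) j * X); [ring|].
rewrite E1, E2; unfold X; ring.
Qed.

(** Mirror image of [jacobi_lower_b], with (x-1) e_j' = (n-j) e_j + j e_(j-1). *)
Lemma jacobi_lower_a a b n x :
  (x - 1) * jacobi_deriv a b n x + a * jacobiP a b n x =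
  (INR n + a) * jacobiP (a - 1) (b + 1) n x.
Proof.
unfold jacobiP, jacobi_deriv.
fold (jacobi_coef a b n).
set (e := fun j => (x - 1) ^ (n - j) * (x + 1) ^ j).
transitivity (/ 2 ^ n * (sumR (S n) (fun j => (INR (n - j) + a) * jacobi_coef a b n j * e j)
   + sumR n (fun j => INR (S j) * jacobi_coef a b n (S j) * e j))).
{ replace (sumR n (fun j => INR (S j) * jacobi_coef a b n (S j) * e j)) with
    (sumR (S n) (fun j => INR j * jacobi_coef a b n j * ((x - 1) * (x - 1) ^ (n - j) * (x + 1) ^ pred j))).
  2: { rewrite sumR_shift; simpl INR at 1; rewrite !Rmult_0_l, Rplus_0_l.
    apply sumR_ext; intros j Hj; unfold e; simpl pred.
    replace (n - j)%nat with (S (n - S j)) by lia; simpl pow; ring. }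
  rewrite <- sumR_plus.
  match goal with |- _ * (?i * ?S1) + _ * (?i * ?S2) = _ =>
    transitivity (i * ((x - 1) * S1 + a * S2)); [ring|] end.
  f_equal.
  rewrite <- !sumR_scal, <- sumR_plus.
  apply sumR_ext; intros j Hj; unfold e, jacobi_coef.
  assert (E1 : INR (n - j) * (x - 1) ^ pred (n - j) * (x - 1) = INR (n - j) * (x - 1) ^ (n - j)).
  { destruct (n - j)%nat; simpl; ring. }
  set (G := gbinom (INR n + a) j * gbinom (INR n + b) (n - j)).
  transitivity (G * (INR (n - j) * (x - 1) ^ pred (n - j) * (x - 1)) * (x + 1) ^ j
     + G * (x - 1) ^ (n - j) * (INR j * (x + 1) ^ pred j * (x - 1))
     + a * G * (x - 1) ^ (n - j) * (x + 1) ^ j).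
  { unfold G; ring. }
  rewrite E1; unfold G; ring. }
rewrite <- Rmult_assoc, (Rmult_comm (INR n + a)), Rmult_assoc; f_equal.
rewrite <- sumR_scal.
change (sumR (S n) (fun j => (INR (n - j) + a) * jacobi_coef a b n j * e j)) with
  (sumR n (fun j => (INR (n - j) + a) * jacobi_coef a b n j * e j) +
   (INR (n - n) + a) * jacobi_coef a b n n * e n).
rewrite (Rplus_comm (sumR n _)), Rplus_assoc, <- sumR_plus, Rplus_comm.
match goal with |- _ = sumR (S n) ?f => change (sumR (S n) f) with (sumR n f + f n) end; f_equal.
2: { unfold e, jacobi_coef; rewrite Nat.sub_diag, !gbinom_0; simpl INR.
  replace (INR n + (a - 1)) with (INR n + a - 1) by ring.
  assert (E := gbinom_absorb (INR n + a) n).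
  replace (INR n + a - INR n) with a in E by ring.
  simpl pow; transitivity (a * gbinom (INR n + a) n * (x + 1) ^ n); [ring|].
  rewrite E; ring. }
apply sumR_ext; intros j Hj; unfold e, jacobi_coef.
destruct (n - j)%nat as [|m] eqn:Em; [lia|].
replace (n - S j)%nat with m by lia.
replace (INR n + (a - 1)) with (INR n + a - 1) by ring.
replace (INR n + (b + 1)) with (INR n + b + 1) by ring.
rewrite gbinom_pascal.
assert (E1 := gbinom_pred (INR n + a) j).
assert (E2 := gbinom_absorb (INR n + a) j).
assert (E3 : INR n = INR j + INR (S m)).
{ rewrite <- plus_INR; f_equal; lia. }
replace (INR n + a - INR j) with (INR (S m) + a) in E2 by (rewrite E3; ring).
set (X := (x - 1) ^ S m * (x + 1) ^ j).
transitivity (((INR (S m) + a) * gbinom (INR n + a) j) * gbinom (INR n + b) (S m) * X +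
 (INR (S j) * gbinom (INR n + a) (S j)) * gbinom (INR n + b) m * X); [ring|].
rewrite E1, E2; unfold X; ring.
Qed.

Lemma jacobiP_at_1 a b n : jacobiP a b n 1 = gbinom (INR n + a) n.
Proof.
unfold jacobiP; simpl sumR.
rewrite (sumR_ext n _ (fun _ => 0 * 0)).
2: { intros i Hi; replace (1 - 1) with 0 by ring; rewrite pow_i by lia; ring. }
rewrite sumR_scal, Nat.sub_diag, gbinom_0; replace (1 + 1) with 2 by ring.
simpl pow; field; apply pow_nonzero; lra.
Qed.

Lemma jacobiP_at_m1 a b n : jacobiP a b n (-1) = (-1) ^ n * gbinom (INR n + b) n.
Proof.
unfold jacobiP; rewrite sumR_shift.
rewrite (sumR_ext n _ (fun _ => 0 * 0)).
2: { intros i Hi; replace (-1 + 1) with 0 by ring; rewrite pow_i by lia; ring. }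
rewrite sumR_scal, Nat.sub_0_r, gbinom_0.
replace (-1 - 1) with ((-1) * 2) by ring. rewrite Rpow_mult_distr.
simpl (_ ^ 0); field; apply pow_nonzero; lra.
Qed.

(** Iterated Darboux transforms need derivatives of every order. Expression trees with a formal
    derivative supply them without differentiability obligations; analysis enters through
    [derivable_ev], wherever [defined_at] holds. *)
Inductive rexp : Type :=
| Var
| Cst (c : R)
| Add (e1 e2 : rexp)
| Mul (e1 e2 : rexp)
| Inv (e : rexp).

Fixpoint ev (e : rexp) (x : R) : R :=
  match e with
  | Var => x
  | Cst c => c
  | Add e1 e2 => ev e1 x + ev e2 x
  | Mul e1 e2 => ev e1 x * ev e2 x
  | Inv e => / ev e x
  end.

Fixpoint der (e : rexp) : rexp :=
  match e with
  | Var => Cst 1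
  | Cst _ => Cst 0
  | Add e1 e2 => Add (der e1) (der e2)
  | Mul e1 e2 => Add (Mul (der e1) e2) (Mul e1 (der e2))
  | Inv e => Mul (Mul (Cst (-1)) (der e)) (Mul (Inv e) (Inv e))
  end.

Fixpoint defined_at (x : R) (e : rexp) : Prop :=
  match e with
  | Var | Cst _ => True
  | Add e1 e2 | Mul e1 e2 => defined_at x e1 /\ defined_at x e2
  | Inv e => defined_at x e /\ ev e x <> 0
  end.

(** The derivative of an inverse has only the old denominator, so no point is lost. *)
Lemma defined_at_der x e : defined_at x e -> defined_at x (der e).
Proof. induction e; simpl; tauto. Qed.

Lemma derivable_ev x e : defined_at x e -> derivable_pt_lim (ev e) x (ev (der e) x).
Proof.
induction e; simpl; intros H.
- apply derivable_pt_lim_id.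
- apply derivable_pt_lim_const.
- apply (derivable_pt_lim_plus (ev e1) (ev e2)); tauto.
- apply (derivable_pt_lim_mult (ev e1) (ev e2)); tauto.
- apply (derivable_pt_lim_ext (fun y => 1 / ev e y)).
  { intros z; unfold Rdiv; apply Rmult_1_l. }
  eapply derivable_pt_lim_eq.
  + apply (derivable_pt_lim_div (fun _ => 1) (ev e)); [apply derivable_pt_lim_const|apply IHe|]; tauto.
  + unfold Rsqr; field; tauto.
Qed.

Fixpoint powE (e : rexp) (n : nat) : rexp :=
  match n with O => Cst 1 | S m => Mul e (powE e m) end.

Fixpoint sumE (n : nat) (f : nat -> rexp) : rexp :=
  match n with O => Cst 0 | S m => Add (sumE m f) (f m) end.

Definition jacobiE (a b : R) (n : nat) : rexp :=
  Mul (Cst (/ 2 ^ n)) (sumE (S n) (fun j =>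
    Mul (Mul (Cst (jacobi_coef a b n j)) (powE (Add Var (Cst (-1))) (n - j)))
        (powE (Add Var (Cst 1)) j))).

Lemma ev_powE e n x : ev (powE e n) x = ev e x ^ n.
Proof. induction n; simpl; [auto|rewrite IHn; auto]. Qed.

Lemma ev_sumE n f x : ev (sumE n f) x = sumR n (fun i => ev (f i) x).
Proof. induction n; simpl; [auto|rewrite IHn; auto]. Qed.

Lemma defined_at_powE x e n : defined_at x e -> defined_at x (powE e n).
Proof. induction n; simpl; tauto. Qed.

Lemma defined_at_sumE x n f : (forall i, defined_at x (f i)) -> defined_at x (sumE n f).
Proof. induction n; simpl; auto. Qed.

Lemma ev_jacobiE a b n x : ev (jacobiE a b n) x = jacobiP a b n x.
Proof.
unfold jacobiE, jacobiP; cbn [ev]; f_equal; rewrite ev_sumE.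
apply sumR_ext; intros i _; cbn [ev]; rewrite !ev_powE; simpl ev.
unfold jacobi_coef; reflexivity.
Qed.

Lemma defined_at_jacobiE a b n x : defined_at x (jacobiE a b n).
Proof.
unfold jacobiE; cbn [defined_at]; split; [exact I|].
apply defined_at_sumE; intros i; repeat split; apply defined_at_powE; simpl; auto.
Qed.

Lemma ev_der_jacobiE a b n x : ev (der (jacobiE a b n)) x = jacobi_deriv a b n x.
Proof.
assert (H := derivable_ev x _ (defined_at_jacobiE a b n x)).
eapply uniqueness_limite; [apply H|].
apply (derivable_pt_lim_ext (jacobiP a b n)).
{ intros z; symmetry; apply ev_jacobiE. }
apply derivable_jacobiP.
Qed.

(** The two contiguous relations lead from (a, b) to (a+1, b-1) and back; the first one and its
    derivative are substituted into the second. The second is multiplied by n + b beforehand, so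
    that this possibly zero factor is never divided out. *)
Lemma jacobi_ode a b n x :
  (1 - x ^ 2) * ev (der (der (jacobiE a b n))) x
  + (b - a - (a + b + 2) * x) * ev (der (jacobiE a b n)) x
  + INR n * (INR n + a + b + 1) * ev (jacobiE a b n) x = 0.
Proof.
set (p := jacobiE a b n); set (q := jacobiE (a + 1) (b - 1) n).
assert (Hp : forall y, defined_at y p) by (intros; apply defined_at_jacobiE).
assert (Hq : forall y, defined_at y q) by (intros; apply defined_at_jacobiE).
assert (E : forall y, (y + 1) * ev (der p) y + b * ev p y = (INR n + b) * ev q y).
{ intros y; unfold p, q; rewrite ev_der_jacobiE, !ev_jacobiE; apply jacobi_lower_b. }
assert (D : 1 * ev (der p) x + (x + 1) * ev (der (der p)) x + b * ev (der p) x =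
   (INR n + b) * ev (der q) x).
{ eapply uniqueness_limite.
  - apply (derivable_pt_lim_plus (fun y => (y + 1) * ev (der p) y) (fun y => b * ev p y)).
    + apply (derivable_pt_lim_mult (fun y => y + 1) (ev (der p))).
      * eapply derivable_pt_lim_eq;
          [apply (derivable_ev x (Add Var (Cst 1))); simpl; auto|simpl; ring].
      * apply derivable_ev, defined_at_der, Hp.
    + apply derivable_pt_lim_scal, derivable_ev, Hp.
  - eapply derivable_pt_lim_ext; [intros z; symmetry; apply E|].
    eapply derivable_pt_lim_eq; [apply derivable_pt_lim_scal, derivable_ev, Hq|reflexivity]. }
assert (F : (x - 1) * ev (der q) x + (a + 1) * ev q x = (INR n + a + 1) * ev p x).
{ unfold p, q; rewrite ev_der_jacobiE, !ev_jacobiE, jacobi_lower_a.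
  replace (a + 1 - 1) with a by ring; replace (b - 1 + 1) with b by ring. ring. }
assert (E0 := E x).
assert ((INR n + b) * ((INR n + a + 1) * ev p x) =
  (x - 1) * ((INR n + b) * ev (der q) x) + (a + 1) * ((INR n + b) * ev q x))
  by (rewrite <- F; ring).
rewrite <- D, <- E0 in H. lra.
Qed.

(** * Darboux chains *)

Definition darboux (yg yf : rexp) : rexp :=
  Add (der yf) (Mul (Mul (Cst (-1)) (Mul (der yg) (Inv yg))) yf).

(** [l] is the eigenvalue; [q] collects what the transformations add to the zero-order term. It
    depends on the chain but is common to all f. *)
Definition solves (b0 b1 l : R) (q : R -> R) (y : rexp) : Prop :=
  forall x, -1 <= x <= 1 ->
    (1 - x ^ 2) * ev (der (der y)) x + (b0 + b1 * x) * ev (der y) x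
    + (l - q x) * ev y x = 0.

Definition regular_on (y : rexp) : Prop :=
  forall x, -1 <= x <= 1 -> defined_at x y.

Definition nonzero_on (y : rexp) : Prop :=
  forall x, -1 <= x <= 1 -> ev y x <> 0.

Lemma regular_darboux yg yf :
  regular_on yg -> regular_on yf -> nonzero_on yg -> regular_on (darboux yg yf).
Proof.
intros Hg Hf n x Hx; specialize (Hg x Hx); specialize (Hf x Hx); specialize (n x Hx).
assert (Hg' := defined_at_der _ _ Hg); assert (Hf' := defined_at_der _ _ Hf).
simpl; tauto.
Qed.

(** The coefficient of v in the first-order relation. At -1 and 1 the logarithmic derivative drops
    out and b0 - b1 or b0 + b1 is left. *)
Definition log_drift (b0 b1 : R) (yg : rexp) : rexp :=
  Add (Mul (Add (Cst 1) (Mul (Cst (-1)) (Mul Var Var))) (Mul (der yg) (Inv yg)))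
      (Add (Cst b0) (Mul (Cst b1) Var)).

(** Both equations are used to eliminate second derivatives; the common potential cancels and leaves
    the difference of the eigenvalues. *)
Lemma darboux_first_order b0 b1 lg lf q yg yf :
  nonzero_on yg -> solves b0 b1 lg q yg -> solves b0 b1 lf q yf ->
  forall x, -1 <= x <= 1 ->
    (1 - x ^ 2) * ev (der (darboux yg yf)) x
    + ev (log_drift b0 b1 yg) x * ev (darboux yg yf) x = (lg - lf) * ev yf x.
Proof.
intros n Hg Hf x Hx.
specialize (n x Hx); specialize (Hg x Hx); specialize (Hf x Hx).
unfold darboux, log_drift; simpl.
set (g := ev yg x) in *; set (g1 := ev (der yg) x) in *.
set (g2 := ev (der (der yg)) x) in *.
set (f := ev yf x) in *; set (f1 := ev (der yf) x) in *.
set (f2 := ev (der (der yf)) x) in *.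
assert (E1 : (1 - x ^ 2) * f2 = - ((b0 + b1 * x) * f1 + (lf - q x) * f)) by lra.
assert (E2 : (1 - x ^ 2) * g2 = - ((b0 + b1 * x) * g1 + (lg - q x) * g)) by lra.
transitivity ((1 - x ^ 2) * f2 - (1 - x ^ 2) * g2 * / g * f - (1 - x ^ 2) * (g1 * / g) * f1
  + (1 - x ^ 2) * (g1 * / g) * (g1 * / g) * f
  + ((1 - x ^ 2) * (g1 * / g) + (b0 + b1 * x)) * (f1 - g1 * / g * f)); [ring|].
rewrite E1, E2; field; exact n.
Qed.

(** Differentiate the first-order relation, replace y_f' by v + (y_g'/y_g) y_f, and use the relation
    again to remove y_f. The new potential involves y_g only, and the term -2 x v' from the leading
    coefficient lowers b1 by 2. *)
Lemma darboux_solves b0 b1 lg q yg :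
  regular_on yg -> nonzero_on yg -> solves b0 b1 lg q yg ->
  exists q', forall lf yf, regular_on yf -> solves b0 b1 lf q yf ->
    solves b0 (b1 - 2) lf q' (darboux yg yf).
Proof.
intros rg n Hg.
set (t := log_drift b0 b1 yg).
exists (fun x => lg - ev (der t) x + ev (der yg) x * / ev yg x * ev t x).
intros lf yf rf Hf x Hx.
assert (E := darboux_first_order b0 b1 lg lf q yg yf n Hg Hf).
assert (rv := regular_darboux yg yf rg rf n).
assert (V : ev (darboux yg yf) x = ev (der yf) x - ev (der yg) x * / ev yg x * ev yf x).
{ simpl; ring. }
assert (Tx : ev t x = (1 - x ^ 2) * (ev (der yg) x * / ev yg x) + (b0 + b1 * x)).
{ unfold t; simpl; ring. }
fold t in E; set (v := darboux yg yf) in *.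
assert (rt : defined_at x t).
{ assert (G := rg x Hx); assert (G' := defined_at_der _ _ G); specialize (n x Hx).
  unfold t; simpl; tauto. }
clearbody v t.
set (L := Add (Mul (Add (Cst 1) (Mul (Cst (-1)) (Mul Var Var))) (der v)) (Mul t v)).
set (M := Mul (Cst (lg - lf)) yf).
assert (D : ev (der L) x = ev (der M) x).
{ assert (rv' := rv x Hx); assert (rv2 := defined_at_der _ _ rv').
  apply (derivative_ext_on (ev L) (ev M) x); [|exact Hx| |].
  - intros y Hy; unfold L, M; simpl; rewrite <- (E y Hy); ring.
  - apply derivable_ev; unfold L; simpl; tauto.
  - apply derivable_ev; unfold M; simpl; split; [exact I|apply rf, Hx]. }
unfold L, M in D; simpl in D.
specialize (E x Hx).
assert (F : ev (der yf) x = ev v x + ev (der yg) x * / ev yg x * ev yf x) by (rewrite V; ring).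
rewrite F in D.
set (s := ev (der yg) x * / ev yg x) in *.
assert ((lg - lf) * (s * ev yf x) =
   s * ((1 - x ^ 2) * ev (der v) x + ev t x * ev v x)) by (rewrite E; ring).
rewrite Tx in *. lra.
Qed.

Section Chain.

Variables (a c : R).

Definition jacobi_eigenvalue (f : nat) : R := INR f * (INR f + a + c + 1).

(** The head of the list is the transformation applied last, so lists are written in reverse order
    of use. *)
Fixpoint chain (l : list nat) (f : nat) : rexp :=
  match l with
  | [] => jacobiE a c f
  | g :: l' => darboux (chain l' g) (chain l' f)
  end.

Fixpoint admissible_chain (l : list nat) : Prop :=
  match l with
  | [] => True
  | g :: l' => nonzero_on (chain l' g) /\ admissible_chain l'
  end.

Lemma chain_regular l f : admissible_chain l -> regular_on (chain l f).
Proof.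
revert f; induction l as [|g l IH]; intros f H.
- intros x _; apply defined_at_jacobiE.
- destruct H; apply regular_darboux; auto.
Qed.

Lemma chain_solves l : admissible_chain l -> exists q, forall f,
  solves (c - a) (- (a + c + 2) - 2 * INR (length l)) (jacobi_eigenvalue f) q (chain l f).
Proof.
induction l as [|g l IH]; intros H.
- exists (fun _ => 0); intros f x Hx; etransitivity; [|apply (jacobi_ode a c f x)].
  unfold jacobi_eigenvalue; cbn [length chain]; change (INR 0) with 0; ring.
- destruct H as [n H]; destruct (IH H) as [q Hq].
  destruct (darboux_solves _ _ _ q _ (chain_regular l g H) n (Hq g)) as [q' Hq'].
  exists q'; intros f; cbn [length chain].
  replace (- (a + c + 2) - 2 * INR (S (length l))) with
    (- (a + c + 2) - 2 * INR (length l) - 2) by (rewrite S_INR; ring).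
  apply Hq'; auto; apply chain_regular, H.
Qed.

Lemma chain_first_order l g f : admissible_chain (g :: l) ->
  forall x, -1 <= x <= 1 ->
    (1 - x ^ 2) * ev (der (chain (g :: l) f)) x
    + ev (log_drift (c - a) (- (a + c + 2) - 2 * INR (length l)) (chain l g)) x
      * ev (chain (g :: l) f) x
    = (jacobi_eigenvalue g - jacobi_eigenvalue f) * ev (chain l f) x.
Proof.
intros [n H]; destruct (chain_solves l H) as [q Hq].
apply (darboux_first_order _ _ _ _ q); auto.
Qed.

(** Where 1 - x^2 vanishes the first-order relation is algebraic and passes the end values down the
    chain. *)
Lemma chain_at_1 l g f : admissible_chain (g :: l) ->
  2 * (a + 1 + INR (length l)) * ev (chain (g :: l) f) 1 =
  (jacobi_eigenvalue f - jacobi_eigenvalue g) * ev (chain l f) 1.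
Proof.
intros H; assert (E := chain_first_order l g f H 1 ltac:(lra)).
assert (T : ev (log_drift (c - a) (- (a + c + 2) - 2 * INR (length l)) (chain l g)) 1
  = - 2 * (a + 1 + INR (length l))) by (unfold log_drift; simpl; ring).
rewrite T in E; lra.
Qed.

Lemma chain_at_m1 l g f : admissible_chain (g :: l) ->
  2 * (c + 1 + INR (length l)) * ev (chain (g :: l) f) (-1) =
  - (jacobi_eigenvalue f - jacobi_eigenvalue g) * ev (chain l f) (-1).
Proof.
intros H; assert (E := chain_first_order l g f H (-1) ltac:(lra)).
assert (T : ev (log_drift (c - a) (- (a + c + 2) - 2 * INR (length l)) (chain l g)) (-1)
  = 2 * (c + 1 + INR (length l))) by (unfold log_drift; simpl; ring).
rewrite T in E; lra.
Qed.

Lemma continuity_ev x e : defined_at x e -> continuity_pt (ev e) x.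
Proof. intros H; eapply derivable_pt_lim_continuity, derivable_ev, H. Qed.

(** The first criterion: [log_drift] at 1 is -2 (a + 1 + n) < 0 with n the length of l, and the
    right-hand side is a nonzero multiple of y_f. *)
Lemma chain_step_monotone l g f :
  admissible_chain (g :: l) -> nonzero_on (chain l f) ->
  jacobi_eigenvalue f <> jacobi_eigenvalue g -> 0 < a + 1 + INR (length l) ->
  nonzero_on (chain (g :: l) f).
Proof.
intros H nf ne p x Hx.
assert (H' := H); destruct H' as [ng H'].
assert (r := chain_regular _ f H); assert (r' := chain_regular _ f H').
(* At -1 the algebraic relation alone would force y_f(-1) = 0. *)
destruct (Req_dec x (-1)) as [->|n].
{ intros E; assert (E1 := chain_at_m1 l g f H); rewrite E, Rmult_0_r in E1.
  assert (n' := nf (-1) ltac:(lra)); symmetry in E1.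
  apply Rmult_integral in E1; lra. }
apply (first_order_no_zero
  (ev (log_drift (c - a) (- (a + c + 2) - 2 * INR (length l)) (chain l g)))
  (ev (chain (g :: l) f)) (ev (der (chain (g :: l) f)))
  (fun x => (jacobi_eigenvalue g - jacobi_eigenvalue f) * ev (chain l f) x)).
- intros y Hy; apply derivable_ev, r, Hy.
- apply chain_first_order, H.
- intros y Hy; apply continuity_pt_scal, continuity_ev, r', Hy.
- intros y Hy; apply Rmult_integral_contrapositive_currified; [lra|apply nf; lra].
- unfold log_drift; simpl; nra.
- lra.
Qed.

(** The second criterion: r = y_f / y_g has derivative w = v / y_g, and the first-order relation
    divided by y_g is the equation of [second_order_no_critical] with delta = Lam_g - Lam_f. Since
    y_g keeps its sign, w inherits equal end signs from v. *)
Lemma chain_step_convex l g f :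
  admissible_chain (g :: l) -> jacobi_eigenvalue f < jacobi_eigenvalue g ->
  0 < ev (chain (g :: l) f) (-1) * ev (chain (g :: l) f) 1 ->
  nonzero_on (chain (g :: l) f).
Proof.
intros H lt p x Hx.
assert (H' := H); destruct H' as [ng H'].
assert (rv := chain_regular _ f H); assert (rf := chain_regular _ f H').
assert (rg := chain_regular _ g H').
assert (E := chain_first_order l g f H).
set (t := log_drift (c - a) (- (a + c + 2) - 2 * INR (length l)) (chain l g)) in *.
set (yg := chain l g) in *; set (yf := chain l f) in *.
assert (V : forall y, ev (chain (g :: l) f) y =
   ev (der yf) y - ev (der yg) y * / ev yg y * ev yf y).
{ intros y; cbn [chain]; unfold darboux; simpl; fold yg yf; ring. }
set (v := chain (g :: l) f) in *.
assert (rt : regular_on t).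
{ intros y Hy; assert (Q := rg y Hy); assert (Q' := defined_at_der _ _ Q).
  assert (n := ng y Hy); unfold t; simpl; tauto. }
clearbody v t yg yf.
set (w := Mul v (Inv yg)).
assert (G : 0 < ev yg (-1) * ev yg 1).
{ apply nonvanishing_same_sign; [lra| |exact ng].
  intros y Hy; apply continuity_ev, rg, Hy. }
assert (wx : ev w x <> 0).
{ apply (second_order_no_critical
   (ev (Add t (Mul (Add (Cst 1) (Mul (Cst (-1)) (Mul Var Var)))
       (Mul (der yg) (Inv yg))))) (ev (Mul yf (Inv yg)))
   (ev w) (ev (der w)) (jacobi_eigenvalue g - jacobi_eigenvalue f)); [lra| | | | | |exact Hx].
  - intros y Hy.
    apply continuity_ev.
    assert (Q := rg y Hy); assert (Q' := defined_at_der _ _ Q); assert (n := ng y Hy); assert (rty := rt y Hy).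
    simpl; tauto.
  - intros y Hy; assert (n := ng y Hy); eapply derivable_pt_lim_eq.
    + apply derivable_ev; simpl; repeat split; [apply rf, Hy|apply rg, Hy|exact n].
    + unfold w; simpl ev; rewrite V; field; exact n.
  - intros y Hy; assert (n := ng y Hy); apply derivable_ev.
    simpl; repeat split; [apply rv, Hy|apply rg, Hy|exact n].
  - intros y Hy; assert (n := ng y Hy); specialize (E y Hy).
    unfold w; simpl ev.
    transitivity (((1 - y ^ 2) * ev (der v) y + ev t y * ev v y) * / ev yg y).
    { field; exact n. }
    rewrite E; field; exact n.
  - unfold w; simpl ev.
    assert (n1 := ng (-1) ltac:(lra)); assert (n2 := ng 1 ltac:(lra)).
    replace (ev v (-1) * / ev yg (-1) * (ev v 1 * / ev yg 1)) with
      (ev v (-1) * ev v 1 * / (ev yg (-1) * ev yg 1)) by (field; auto).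
    apply Rmult_lt_0_compat; [exact p|apply Rinv_0_lt_compat, G]. }
intros vx; apply wx; unfold w; simpl ev; rewrite vx; ring.
Qed.

End Chain.

(** * Linear combinations vanishing to high order at a point *)

Definition sumL (l : list nat) (F : nat -> R) : R :=
  fold_right (fun f acc => F f + acc) 0 l.

Lemma sumL_ext l F G : (forall f, In f l -> F f = G f) -> sumL l F = sumL l G.
Proof.
induction l as [|g l IH]; simpl; intros H; [auto|].
rewrite (H g), IH by auto; auto.
Qed.

Lemma sumL_plus l F G : sumL l (fun f => F f + G f) = sumL l F + sumL l G.
Proof. induction l; simpl; [ring|rewrite IHl; ring]. Qed.

Lemma sumL_scal l k F : sumL l (fun f => k * F f) = k * sumL l F.
Proof. induction l; simpl; [ring|rewrite IHl; ring]. Qed.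

Lemma sumL_perm l l' F : Permutation l l' -> sumL l F = sumL l' F.
Proof. induction 1; simpl; lra. Qed.

Definition vanishes (n : nat) (x0 : R) (l : list nat) (k : nat -> R) (Y : nat -> rexp) :=
  forall i, (i < n)%nat -> sumL l (fun f => k f * ev (Nat.iter i der (Y f)) x0) = 0.

Lemma iter_der_Add i e1 e2 :
  Nat.iter i der (Add e1 e2) = Add (Nat.iter i der e1) (Nat.iter i der e2).
Proof. induction i; simpl; [auto|rewrite IHi; auto]. Qed.

Lemma vanishes_der n x0 l k Y :
  vanishes (S n) x0 l k Y -> vanishes n x0 l k (fun f => der (Y f)).
Proof.
intros H i Hi; rewrite <- (H (S i)) by lia; apply sumL_ext; intros f _.
rewrite Nat.iter_succ_r; auto.
Qed.

Lemma vanishes_le n m x0 l k Y :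
  (n <= m)%nat -> vanishes m x0 l k Y -> vanishes n x0 l k Y.
Proof. intros nm H i Hi; apply H; lia. Qed.

Lemma vanishes_Add n x0 l k Y Z :
  vanishes n x0 l k Y -> vanishes n x0 l k Z ->
  vanishes n x0 l k (fun f => Add (Y f) (Z f)).
Proof.
intros HY HZ i Hi.
transitivity (sumL l (fun f => k f * ev (Nat.iter i der (Y f)) x0) +
  sumL l (fun f => k f * ev (Nat.iter i der (Z f)) x0)).
{ rewrite <- sumL_plus; apply sumL_ext; intros f _; rewrite iter_der_Add; simpl; ring. }
rewrite HY, HZ by auto; ring.
Qed.

Lemma vanishes_Mul n x0 l k s Y :
  vanishes n x0 l k Y -> vanishes n x0 l k (fun f => Mul s (Y f)).
Proof.
revert s Y; induction n as [|n IH]; intros s Y H i Hi; [lia|].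
destruct i as [|i].
{ transitivity (ev s x0 * sumL l (fun f => k f * ev (Nat.iter 0 der (Y f)) x0)).
  { rewrite <- sumL_scal; apply sumL_ext; intros f _; simpl; ring. }
  rewrite (H 0%nat) by lia; ring. }
assert (V : vanishes n x0 l k (fun f => Add (Mul (der s) (Y f)) (Mul s (der (Y f))))).
{ apply vanishes_Add; apply IH; [apply vanishes_le with (S n); auto|apply vanishes_der, H]. }
rewrite <- (V i) by lia; apply sumL_ext; intros f _.
rewrite Nat.iter_succ_r; reflexivity.
Qed.

(** A transformation is linear in y_f with coefficients independent of f; it involves one derivative
    and so costs one order of vanishing. *)
Lemma vanishes_chain a c x0 l k s n :
  vanishes (n + length s) x0 l k (jacobiE a c) -> vanishes n x0 l k (chain a c s).
Proof.
revert n; induction s as [|g s IH]; intros n H; [rewrite Nat.add_0_r in H; exact H|].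
assert (V : vanishes (S n) x0 l k (chain a c s)).
{ apply IH; simpl in H; replace (S n + length s)%nat with (n + S (length s))%nat by lia; exact H. }
cbn [chain]; apply vanishes_Add; [apply vanishes_der, V|].
apply vanishes_Mul, vanishes_le with (S n); auto.
Qed.

(** The transform of a function by itself is zero, and zero is preserved by the transformations that
    follow. *)
Lemma chain_killed a c l f : admissible_chain a c l -> In f l ->
  forall x, -1 <= x <= 1 -> ev (chain a c l f) x = 0.
Proof.
induction l as [|g l IH]; intros H Hf; [destruct Hf|].
destruct H as [n H].
destruct (Nat.eq_dec f g) as [->|ne].
{ intros x Hx; cbn [chain]; unfold darboux; simpl; field; apply n, Hx. }
assert (Hf' : In f l) by (destruct Hf; congruence).
intros x Hx; specialize (IH H Hf').
assert (D : ev (der (chain a c l f)) x = 0).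
{ apply (derivative_ext_on (ev (chain a c l f)) (fun _ => 0) x); auto.
  - apply derivable_ev, chain_regular; auto.
  - apply derivable_pt_lim_const. }
cbn [chain]; unfold darboux; simpl; rewrite D, IH by auto; ring.
Qed.

(** Transforming by the tail kills every term except that of the head g and leaves one order of
    vanishing: k_g times a nonzero value is zero. The tail follows by induction. *)
Lemma wronskian_independent a c l k x0 :
  admissible_chain a c l -> -1 <= x0 <= 1 ->
  vanishes (length l) x0 l k (jacobiE a c) -> forall f, In f l -> k f = 0.
Proof.
induction l as [|g l IH]; intros H Hx V f Hf; [destruct Hf|].
destruct H as [n H].
assert (kg : k g = 0).
{ assert (E := vanishes_chain a c x0 (g :: l) k l 1 V 0%nat ltac:(lia)).
  simpl in E; fold (sumL l (fun f => k f * ev (chain a c l f) x0)) in E.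
  rewrite (sumL_ext l _ (fun _ => 0 * 0)) in E.
  2: { intros h Hh; rewrite chain_killed; auto; ring. }
  rewrite sumL_scal in E; assert (nx := n x0 Hx).
  assert (E' : k g * ev (chain a c l g) x0 = 0) by lra.
  apply Rmult_integral in E'; tauto. }
destruct Hf as [<-|Hf]; [exact kg|].
apply IH; auto; intros i Hi; rewrite <- (V i) by (simpl; lia).
simpl; rewrite kg; fold (sumL l (fun f => k f * ev (Nat.iter i der (jacobiE a c f)) x0)); ring.
Qed.

(** * Determinants *)

Module DetKernel.
Import ssreflect ssrfun ssrbool eqtype ssrnat seq fintype bigop ssralg matrix mxalgebra Rstruct GRing.Theory.
Local Open Scope ring_scope.

Definition toM (k : nat) (M : nat -> nat -> R) : 'M[R]_k := \matrix_(i < k, j < k) M i j.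

Lemma sumRE n (f : nat -> R) : sumR n f = \sum_(i < n) f i.
Proof. by elim: n => [|n IH] /=; rewrite ?big_ord0 // big_ord_recr IH. Qed.

Lemma detRE k M : detR k M = \det (toM k M) :> R.
Proof.
elim: k M => [|k IH] M; first by rewrite det_mx00.
have -> : detR k.+1 M = sumR k.+1 (fun j => Rmult (Rmult (pow (-1)%R j) (M 0%nat j))
   (detR k (fun r c => M (S r) (if Nat.ltb c j then c else S c)))) by [].
rewrite (expand_det_row _ ord0) sumRE; apply: eq_bigr => j _.
rewrite /cofactor mxE IH add0n /= RpowE !RmultE.
rewrite -mulrA mulrCA; congr (_ * (_ * _)).
congr (\det _); apply/matrixP => r c; rewrite !mxE /=.
by rewrite /bump leq0n add1n; case: Nat.ltb_spec => [/ltP|/leP] h;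
  rewrite ?h // leqNgt h.
Qed.

(** The vector acts on rows: in the Wronskian its entries are the coefficients of a combination of
    functions, with one equation per derivative. *)
Lemma detR_kernel k M : detR k M = IZR 0 ->
  exists v : nat -> R, (exists2 r, (r < k)%coq_nat & v r <> IZR 0) /\
    forall j, (j < k)%coq_nat -> sumR k (fun r => Rmult (v r) (M r j)) = IZR 0.
Proof.
rewrite detRE => /eqP /det0P [v v0 vM].
exists (fun r => if insub r is Some i then v ord0 i else 0%R); split.
  move/rV0Pn: v0 => [i vi]; exists i; first exact/ltP.
  by rewrite valK; apply/eqP.
move=> j /ltP jk; rewrite sumRE.
move/rowP/(_ (Ordinal jk)): vM; rewrite !mxE => vM; rewrite -[RHS]vM.
by apply: eq_bigr => i _; rewrite valK mxE.
Qed.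

Lemma detR_mul k M K :
  detR k (fun r c => sumR k (fun i => Rmult (M r i) (K i c))) = Rmult (detR k M) (detR k K).
Proof.
rewrite !detRE RmultE -det_mulmx; congr (\det _); apply/matrixP => r c.
by rewrite !mxE sumRE; apply: eq_bigr => i _; rewrite !mxE.
Qed.

Lemma detR_upper k K : (forall i j, (j < i)%coq_nat -> K i j = IZR 0) ->
  detR k K = prodR k (fun i => K i i).
Proof.
move=> up; rewrite detRE -det_tr det_trig; last first.
  by apply/is_trig_mxP => i j ij; rewrite !mxE; apply/up/ltP.
rewrite (eq_bigr (fun i : 'I_k => K i i)); last by move=> i _; rewrite !mxE.
by elim: k => [|k IH]; rewrite ?big_ord0 // big_ord_recr /= -IH.
Qed.

Lemma detR_ext k M K : (forall r c, (r < k)%coq_nat -> (c < k)%coq_nat -> M r c = K r c) ->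
  detR k M = detR k K.
Proof.
move=> MK; rewrite !detRE; congr (\det _); apply/matrixP => r c.
by rewrite !mxE; apply: MK; apply/ltP.
Qed.

End DetKernel.

(** * Reduction of Omega to a Wronskian *)

(* Coefficients expressing [poch (b - f) j * jacobiP (a + j) (- b - j) f] through
   the derivatives of [jacobiP a (- b) f], uniformly in [f]. *)
Fixpoint kap (b : R) (j i : nat) : R :=
  match j with
  | O => match i with O => 1 | S _ => 0 end
  | S j' => (b + INR j' - INR i) * kap b j' i
            - match i with O => 0 | S i' => kap b j' i' end
  end.

Lemma kap_above b j i : (j < i)%nat -> kap b j i = 0.
Proof.
revert i; induction j as [|j IH]; intros [|i] H; simpl; auto; try lia.
rewrite !IH by lia; ring.
Qed.

Lemma kap_diag b j : kap b j j = (-1) ^ j.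
Proof.
induction j as [|j IH]; [auto|].
simpl kap; rewrite kap_above, IH by lia; simpl; ring.
Qed.

Lemma regular_jacobi_iter a c f i x : defined_at x (Nat.iter i der (jacobiE a c f)).
Proof. induction i; simpl; [apply defined_at_jacobiE|apply defined_at_der; auto]. Qed.

(** With T_j for the left-hand side, [jacobi_lower_b] says T_(j+1) = (b + j) T_j - (1 + x) T_j',
    because its factor f - b - j is minus the next factor of the Pochhammer symbol. This is the
    recursion of [kap]. The free bound K lets all columns share one matrix product. *)
Lemma jacobiP_contiguous a b f j K x : (j < K)%nat ->
  poch (b - INR f) j * jacobiP (a + INR j) (- b - INR j) f x =
  sumR K (fun i => kap b j i *
    ((1 + x) ^ i * ev (Nat.iter i der (jacobiE a (- b) f)) x)).
Proof.
set (P := fun i => ev (Nat.iter i der (jacobiE a (- b) f))).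
intros H.
change (poch (b - INR f) j * jacobiP (a + INR j) (- b - INR j) f x =
  sumR K (fun i => kap b j i * ((1 + x) ^ i * P i x))).
revert K x H; induction j as [|j IH]; intros K x H.
- destruct K as [|K]; [lia|]; rewrite sumR_shift.
  rewrite (sumR_ext K _ (fun _ => 0 * 0)) by (intros; simpl; ring).
  rewrite sumR_scal; change (P 0%nat x) with (ev (jacobiE a (- b) f) x).
  rewrite ev_jacobiE; simpl.
  replace (a + 0) with a by ring; replace (- b - 0) with (- b) by ring.
  unfold poch; simpl; ring.
- destruct K as [|K]; [lia|].
  set (T := fun y => poch (b - INR f) j * jacobiP (a + INR j) (- b - INR j) f y).
  set (T1 := poch (b - INR f) j * jacobi_deriv (a + INR j) (- b - INR j) f x).
  assert (dT : derivable_pt_lim T x T1) by apply derivable_pt_lim_scal, derivable_jacobiP.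
  assert (L := jacobi_lower_b (a + INR j) (- b - INR j) f x).
  replace (a + INR j + 1) with (a + INR (S j)) in L by (rewrite S_INR; ring).
  replace (- b - INR j - 1) with (- b - INR (S j)) in L by (rewrite S_INR; ring).
  transitivity ((b + INR j) * T x - (x + 1) * T1).
  { unfold poch; simpl prodR; fold (poch (b - INR f) j); unfold T, T1.
    transitivity (- poch (b - INR f) j *
      ((INR f + (- b - INR j)) * jacobiP (a + INR (S j)) (- b - INR (S j)) f x)); [ring|].
    rewrite <- L; ring. }
  assert (E : T1 = sumR K (fun i => kap b j i *
     (INR i * (1 + x) ^ pred i * P i x + (1 + x) ^ i * P (S i) x))).
  { apply (uniqueness_limite T x); [exact dT|].
    apply (derivable_pt_lim_ext (fun y => sumR K (fun i => kap b j i * ((1 + y) ^ i * P i y)))).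
    { intros z; symmetry; apply IH; lia. }
    apply (derivable_pt_lim_sumR K (fun i y => kap b j i * ((1 + y) ^ i * P i y))).
    intros i _; apply (derivable_pt_lim_scal (fun y => (1 + y) ^ i * P i y)).
    apply (derivable_pt_lim_mult (fun y => (1 + y) ^ i) (P i)).
    - apply (derivable_pt_lim_ext (fun y => (y + 1) ^ i)); [intros; f_equal; ring|].
      rewrite (Rplus_comm 1 x); apply derivable_pt_lim_shift_pow.
    - apply derivable_ev, regular_jacobi_iter. }
  rewrite E; unfold T; rewrite (IH (S K) x) by lia; fold (P).
  rewrite <- !sumR_scal.
  transitivity (sumR (S K) (fun i => (b + INR j - INR i) * kap b j i * ((1 + x) ^ i * P i x))
     - sumR K (fun i => kap b j i * ((1 + x) ^ S i * P (S i) x))).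
  { transitivity (sumR (S K) (fun i => (b + INR j) * (kap b j i * ((1 + x) ^ i * P i x)))
      - (sumR (S K) (fun i => INR i * (kap b j i * ((1 + x) ^ i * P i x)))
        + sumR K (fun i => kap b j i * ((1 + x) ^ S i * P (S i) x)))).
    - f_equal; f_equal. simpl (sumR (S K) _); rewrite (kap_above b j K) by lia.
      rewrite Rmult_0_l, Rmult_0_r, Rplus_0_r, <- sumR_plus; apply sumR_ext; intros i _.
      destruct i; simpl; ring.
    - transitivity (sumR (S K) (fun i => (b + INR j) * (kap b j i * ((1 + x) ^ i * P i x)))
        + (-1) * sumR (S K) (fun i => INR i * (kap b j i * ((1 + x) ^ i * P i x)))
        - sumR K (fun i => kap b j i * ((1 + x) ^ S i * P (S i) x))); [ring|].
      f_equal; rewrite <- sumR_scal, <- sumR_plus; apply sumR_ext; intros; ring. }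
  transitivity (sumR (S K) (fun i => (b + INR j - INR i) * kap b j i * ((1 + x) ^ i * P i x))
     + sumR (S K) (fun i => (-1) * match i with O => 0 | S i' => kap b j i' end * ((1 + x) ^ i * P i x))).
  { rewrite (sumR_shift K (fun i => (-1) * _ * _)).
    rewrite (sumR_ext K (fun i => -1 * kap b j i * _)
      (fun i => (-1) * (kap b j i * ((1 + x) ^ S i * P (S i) x)))) by (intros; ring).
    rewrite sumR_scal; ring. }
  rewrite <- sumR_plus; apply sumR_ext; intros i _; simpl kap; fold (P i x); ring.
Qed.

Definition wronskian (a c : R) (F : list nat) (x : R) : R :=
  detR (length F) (fun r i => ev (Nat.iter i der (jacobiE a c (nth r F 0%nat))) x).

(** W is the Wronskian matrix times an upper triangular one with diagonal entries (-1)^i (1 +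
    x)^(k-1), whose determinant supplies exactly the denominator of Omega. *)
Lemma OmegaRaw_wronskian a b F : exists s, s <> 0 /\
  forall x, x <> -1 -> OmegaRaw a b F x = s * wronskian a (- b) F x.
Proof.
exists (prodR (length F) (fun i => (-1) ^ i)); split.
{ induction (length F); simpl; [lra|].
  apply Rmult_integral_contrapositive_currified; [auto|apply pow_nonzero; lra]. }
intros x nx; unfold OmegaRaw, wronskian.
set (k := length F).
rewrite (DetKernel.detR_ext k _ (fun r c => sumR k (fun i =>
   ev (Nat.iter i der (jacobiE a (- b) (nth r F 0%nat))) x *
   (kap b c i * (1 + x) ^ (i + (k - 1 - c)))))).
2: { intros r c Hr Hc; unfold Wmat; fold k.
  transitivity ((1 + x) ^ (k - 1 - c) * (poch (b - INR (nth r F 0%nat)) c *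
     jacobiP (a + INR c) (- b - INR c) (nth r F 0%nat) x)); [ring|].
  rewrite (jacobiP_contiguous _ _ _ _ k) by auto.
  rewrite <- sumR_scal; apply sumR_ext; intros; rewrite pow_add; ring. }
rewrite (DetKernel.detR_mul k _ (fun i c => kap b c i * (1 + x) ^ (i + (k - 1 - c)))).
rewrite (DetKernel.detR_upper k (fun i c => kap b c i * (1 + x) ^ (i + (k - 1 - c))))
  by (intros; rewrite kap_above by auto; ring).
set (w := detR k _).
replace (prodR k (fun i => kap b i i * (1 + x) ^ (i + (k - 1 - i)))) with
  (prodR k (fun i => (-1) ^ i) * (1 + x) ^ (k * (k - 1))).
{ field; apply pow_nonzero; lra. }
rewrite (prodR_ext k (fun i => kap b i i * _) (fun i => (-1) ^ i * (1 + x) ^ (k - 1))).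
2: { intros i Hi; rewrite kap_diag; do 2 f_equal; lia. }
generalize (k - 1)%nat; intros m; clear; induction k as [|k IH]; simpl; [ring|].
rewrite pow_add, <- IH; ring.
Qed.

Lemma continuity_sumR n (f : nat -> R -> R) x :
  (forall i, continuity_pt (f i) x) -> continuity_pt (fun y => sumR n (fun i => f i y)) x.
Proof.
intros H; induction n; simpl; [apply continuity_pt_const; intros ? ?; auto|].
apply (continuity_pt_plus (fun y => sumR n (fun i => f i y)) (f n)); auto.
Qed.

Lemma continuity_detR k (M : nat -> nat -> R -> R) x :
  (forall r c, continuity_pt (M r c) x) ->
  continuity_pt (fun y => detR k (fun r c => M r c y)) x.
Proof.
revert M; induction k as [|k IH]; intros M H.
{ apply continuity_pt_const; intros ? ?; auto. }
apply (continuity_sumR (S k) (fun j y => (-1) ^ j * M 0%nat j y *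
      detR k (fun r c => M (S r) (if Nat.ltb c j then c else S c) y))).
intros j.
apply (continuity_pt_mult (fun y => (-1) ^ j * M 0%nat j y)
  (fun y => detR k (fun r c => M (S r) (if Nat.ltb c j then c else S c) y))).
- apply continuity_pt_scal, H.
- apply (IH (fun r c => M (S r) (if Nat.ltb c j then c else S c))); auto.
Qed.

(** The quotient defining Omega is meaningless at -1, so the value is read as a limit through y <>
    -1, where it is a multiple of a continuous function. *)
Lemma wronskian_limit a b F x : wronskian a (- b) F x <> 0 ->
  exists l, l <> 0 /\ limit1_in (OmegaRaw a b F) (fun y => y <> -1) l x.
Proof.
intros nz; destruct (OmegaRaw_wronskian a b F) as [s [s0 Hs]].
exists (s * wronskian a (- b) F x); split.
{ apply Rmult_integral_contrapositive_currified; auto. }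
assert (C : continuity_pt (fun y => s * wronskian a (- b) F y) x).
{ apply (continuity_pt_scal (wronskian a (- b) F)).
  apply (continuity_detR _ (fun r i => ev (Nat.iter i der (jacobiE a (- b) (nth r F 0%nat))))).
  intros; apply continuity_ev, regular_jacobi_iter. }
intros e e0; destruct (C e e0) as [d [d0 Hd]].
exists d; split; [exact d0|]; intros y [ny Hy].
rewrite Hs by exact ny.
(* [continuity_pt] speaks only of points different from x. *)
destruct (Req_dec x y) as [->|n].
{ simpl; unfold Rdist; rewrite Rminus_diag, Rabs_R0; exact e0. }
apply Hd; split; [split; [exact I|exact n]|exact Hy].
Qed.

Fixpoint position (f : nat) (l : list nat) : nat :=
  match l with
  | [] => O
  | g :: l' => if Nat.eq_dec f g then O else S (position f l')
  end.

Lemma position_nth l r : NoDup l -> (r < length l)%nat -> position (nth r l 0%nat) l = r.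
Proof.
revert r; induction l as [|g l IH]; intros r H Hr; [simpl in Hr; lia|].
inversion_clear H; destruct r as [|r]; simpl.
- destruct (Nat.eq_dec g g); congruence.
- simpl in Hr; destruct (Nat.eq_dec (nth r l 0%nat) g) as [e|].
  + exfalso; apply H0; rewrite <- e; apply nth_In; lia.
  + f_equal; apply IH; auto; lia.
Qed.

Lemma sumL_nth l G : sumL l G = sumR (length l) (fun r => G (nth r l 0%nat)).
Proof.
induction l as [|g l IH]; [auto|].
cbn [length]; rewrite sumR_shift; simpl; rewrite <- IH; reflexivity.
Qed.

(** A zero determinant yields coefficients indexed by rows; [position] reindexes them by degree, so
    that they survive the reordering of F into l. *)
Lemma wronskian_nonzero a c F l x : NoDup F -> Permutation l F ->
  admissible_chain a c l -> -1 <= x <= 1 -> wronskian a c F x <> 0.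
Proof.
intros ND P H Hx E; destruct (DetKernel.detR_kernel _ _ E) as [v [[r Hr vr] Hv]].
apply vr; rewrite <- (position_nth F r ND Hr).
apply (wronskian_independent a c l (fun f => v (position f F)) x H Hx).
2: { eapply Permutation_in; [apply Permutation_sym, P|apply nth_In, Hr]. }
intros i Hi; rewrite (Permutation_length P) in Hi.
rewrite (sumL_perm _ _ _ P), sumL_nth, <- (Hv i Hi).
apply sumR_ext; intros j Hj; rewrite position_nth by auto; reflexivity.
Qed.

(** * The Gamma function *)

(** Convexity of exp: the tangent at z w lies below exp at 0 and at w, and the two inequalities are
    averaged with weights 1 - z and z. *)
Lemma exp_mult_le z w : 0 <= z <= 1 -> exp (z * w) <= 1 + z * (exp w - 1).
Proof.
intros Hz.
assert (T : forall y, 1 + y <= exp y).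
{ intros y; destruct (Req_dec y 0) as [->|n]; [rewrite exp_0; lra|].
  left; apply exp_ineq1; auto. }
assert (E0 : exp (z * w) * (1 - z * w) <= 1).
{ assert (exp (z * w) * exp (- (z * w)) = 1).
  { rewrite <- exp_plus, Rplus_opp_r; apply exp_0. }
  assert (P := exp_pos (z * w)); assert (Q := T (- (z * w))).
  assert (exp (z * w) * (1 + - (z * w)) <= exp (z * w) * exp (- (z * w)))
    by (apply Rmult_le_compat_l; lra). lra. }
assert (E1 : exp (z * w) * (1 + (1 - z) * w) <= exp w).
{ assert (exp (z * w) * exp ((1 - z) * w) = exp w).
  { rewrite <- exp_plus; f_equal; ring. }
  assert (P := exp_pos (z * w)); assert (Q := T ((1 - z) * w)).
  assert (exp (z * w) * (1 + (1 - z) * w) <= exp (z * w) * exp ((1 - z) * w))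
    by (apply Rmult_le_compat_l; lra). lra. }
assert ((1 - z) * (exp (z * w) * (1 - z * w)) <= (1 - z) * 1) by (apply Rmult_le_compat_l; lra).
assert (z * (exp (z * w) * (1 + (1 - z) * w)) <= z * exp w) by (apply Rmult_le_compat_l; lra).
lra.
Qed.

Definition not_pole (z : R) : Prop := forall n, z <> - INR n.

Lemma not_pole_prod z n : not_pole z -> prodR n (fun i => z + INR i) <> 0.
Proof.
intros H; induction n; simpl; [lra|].
apply Rmult_integral_contrapositive_currified; auto.
specialize (H n); lra.
Qed.

Lemma not_pole_succ z : not_pole z -> not_pole (z + 1).
Proof. intros H n; specialize (H (S n)); rewrite S_INR in H; lra. Qed.

Lemma not_pole_pos z : 0 < z -> not_pole z.
Proof. intros H n; assert (P := pos_INR n); lra. Qed.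

Lemma gamma_seq_succ z n : not_pole z -> (0 < n)%nat ->
  gamma_seq (z + 1) n = z * gamma_seq z n * ((INR n + 0) / (INR n + (z + 1))).
Proof.
intros H n0; unfold gamma_seq.
assert (E : z * prodR (S n) (fun i => z + 1 + INR i) =
   prodR (S n) (fun i => z + INR i) * (INR n + (z + 1))).
{ transitivity (prodR (S (S n)) (fun i => z + INR i)).
  - rewrite (prodR_shift (S n) (fun i => z + INR i)); change (INR 0) with 0.
    rewrite Rplus_0_r; f_equal.
    apply prodR_ext; intros; rewrite S_INR; ring.
  - change (prodR (S (S n)) (fun i => z + INR i)) with
      (prodR (S n) (fun i => z + INR i) * (z + INR (S n))); rewrite S_INR; ring. }
assert (N1 := not_pole_prod z (S n) H).
assert (N2 := not_pole_prod (z + 1) (S n) (not_pole_succ z H)).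
assert (z0 := H 0%nat); simpl in z0.
assert (N3 : INR n + (z + 1) <> 0).
{ specialize (H (S n)); rewrite S_INR in H; lra. }
assert (0 < INR n) by (apply lt_0_INR; lia).
rewrite Rpower_plus, Rpower_1 by auto.
set (p1 := prodR (S n) (fun i => z + INR i)) in *.
set (p2 := prodR (S n) (fun i => z + 1 + INR i)) in *.
replace p1 with (z * p2 / (INR n + (z + 1))) by (rewrite E; field; auto).
field; repeat split; auto; lra.
Qed.

Lemma ratio_cv c d : Un_cv (fun n => (INR n + c) / (INR n + d)) 1.
Proof.
intros e e0.
destruct (INR_unbounded (Rabs d + Rabs (c - d) / e)) as [N HN].
exists N; intros n Hn; unfold Rdist.
assert (INR N <= INR n) by (apply le_INR; lia).
assert (A := Rle_abs (- d)); rewrite Rabs_Ropp in A.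
assert (0 <= Rabs (c - d) / e).
{ apply Rmult_le_pos; [apply Rabs_pos|left; apply Rinv_0_lt_compat; auto]. }
assert (P : 0 < INR n + d) by lra.
replace ((INR n + c) / (INR n + d) - 1) with ((c - d) / (INR n + d)) by (field; lra).
unfold Rdiv; rewrite Rabs_mult, (Rabs_pos_eq (/ _)) by (left; apply Rinv_0_lt_compat; auto).
apply Rmult_lt_reg_r with (INR n + d); [auto|].
rewrite Rmult_assoc, Rinv_l, Rmult_1_r by lra.
apply Rmult_lt_reg_r with (/ e); [apply Rinv_0_lt_compat; auto|].
replace (e * (INR n + d) * / e) with (INR n + d) by (field; lra).
unfold Rdiv in *; lra.
Qed.

Lemma Un_cv_ext_pos u v l :
  (forall n, (0 < n)%nat -> u n = v n) -> Un_cv u l -> Un_cv v l.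
Proof.
intros E H e e0; destruct (H e e0) as [N HN].
exists (S N); intros n Hn; rewrite <- E by lia; apply HN; lia.
Qed.

Lemma gamma_seq_pos z n : 0 < z -> (0 < n)%nat -> 0 < gamma_seq z n.
Proof.
intros z0 n0; unfold gamma_seq.
apply Rmult_lt_0_compat.
- apply Rmult_lt_0_compat; [apply INR_fact_pos|apply exp_pos].
- apply Rinv_0_lt_compat.
  generalize (S n); intros m; induction m; simpl; [lra|].
  assert (P := pos_INR m); apply Rmult_lt_0_compat; lra.
Qed.

(** From n = 1 on the sequence increases, while its product with (n + z)/n decreases and so bounds
    it. Both facts come from the estimates of E = ((n+1)/n)^z given by [exp_mult_le]. The limit is
    at least the first term, hence positive. *)
Lemma gamma_cv_unit z : 0 < z <= 1 -> exists l, 0 < l /\ Un_cv (gamma_seq z) l.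
Proof.
intros Hz.
assert (step : forall n, (0 < n)%nat -> exists E,
   1 / (1 - z / (INR n + 1)) <= E <= 1 + z / INR n /\
   gamma_seq z (S n) = gamma_seq z n * ((INR n + 1) / (INR n + 1 + z)) * E).
{ intros n Hn; assert (n0 : 0 < INR n) by (apply lt_0_INR; lia).
  set (L := ln (INR n + 1) - ln (INR n)).
  assert (eL : exp L = (INR n + 1) / INR n).
  { unfold L, Rminus; rewrite exp_plus, exp_Ropp, !exp_ln by lra; reflexivity. }
  exists (exp (z * L)); split; [split|].
  - assert (Q := exp_mult_le z (- L) ltac:(lra)).
    rewrite exp_Ropp, eL in Q.
    replace (z * - L) with (- (z * L)) in Q by ring; rewrite exp_Ropp in Q.
    assert (P := exp_pos (z * L)).
    replace (1 + z * (/ ((INR n + 1) / INR n) - 1)) with (1 - z / (INR n + 1)) in Q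
      by (field; lra).
    unfold Rdiv at 1; rewrite Rmult_1_l, <- (Rinv_inv (exp (z * L))).
    apply Rinv_le_contravar; [apply Rinv_0_lt_compat; auto|auto].
  - assert (Q := exp_mult_le z L ltac:(lra)); rewrite eL in Q.
    replace (1 + z * ((INR n + 1) / INR n - 1)) with (1 + z / INR n) in Q by (field; lra).
    exact Q.
  - unfold gamma_seq.
    change (fact (S n)) with (S n * fact n)%nat; rewrite mult_INR.
    change (prodR (S (S n)) (fun i => z + INR i)) with
      (prodR (S n) (fun i => z + INR i) * (z + INR (S n))).
    rewrite S_INR.
    assert (Rpower (INR n + 1) z = Rpower (INR n) z * exp (z * L)).
    { unfold Rpower; rewrite <- exp_plus; f_equal; unfold L; ring. }
    rewrite H; assert (N := not_pole_prod z (S n) (not_pole_pos z ltac:(lra))).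
    field; repeat split; auto; lra. }
set (u := fun n => gamma_seq z (n + 1)).
assert (grow : Un_growing u).
{ intros n; unfold u; destruct (step (n + 1)%nat ltac:(lia)) as [E [[E1 _] Eq]].
  change (S n + 1)%nat with (S (n + 1)); rewrite Eq.
  assert (n0 : 0 < INR (n + 1)) by (apply lt_0_INR; lia).
  assert (g0 := gamma_seq_pos z (n + 1) ltac:(lra) ltac:(lia)).
  set (m := INR (n + 1)) in *.
  rewrite Rmult_assoc; rewrite <- (Rmult_1_r (gamma_seq z (n + 1))) at 1.
  apply Rmult_le_compat_l; [lra|].
  apply Rle_trans with ((m + 1) / (m + 1 + z) * (1 / (1 - z / (m + 1)))).
  - replace ((m + 1) / (m + 1 + z) * (1 / (1 - z / (m + 1)))) with
      ((m + 1) ^ 2 / ((m + 1) ^ 2 - z ^ 2)) by (field; repeat split; nra).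
    assert (0 < (m + 1) ^ 2 - z ^ 2) by nra.
    apply Rmult_le_reg_r with ((m + 1) ^ 2 - z ^ 2); [auto|].
    unfold Rdiv; rewrite Rmult_assoc, Rinv_l by lra; nra.
  - apply Rmult_le_compat_l; [|exact E1].
    apply Rmult_le_pos; [lra|left; apply Rinv_0_lt_compat; lra]. }
assert (bound : forall n, gamma_seq z (n + 1) * ((INR (n + 1) + z) / INR (n + 1))
   <= gamma_seq z 1 * (1 + z)).
{ induction n as [|n IH].
  - simpl; right; field.
  - eapply Rle_trans; [|exact IH].
    destruct (step (n + 1)%nat ltac:(lia)) as [E [[_ E2] Eq]].
    change (S n + 1)%nat with (S (n + 1)); rewrite Eq, S_INR.
    assert (n0 : 0 < INR (n + 1)) by (apply lt_0_INR; lia).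
    assert (g0 := gamma_seq_pos z (n + 1) ltac:(lra) ltac:(lia)).
    set (m := INR (n + 1)) in *.
    replace (gamma_seq z (n + 1) * ((m + 1) / (m + 1 + z)) * E * ((m + 1 + z) / (m + 1)))
      with (gamma_seq z (n + 1) * E) by (field; lra).
    apply Rmult_le_compat_l; [lra|].
    replace ((m + z) / m) with (1 + z / m) by (field; lra); exact E2. }
destruct (growing_cv u grow) as [l Hl].
{ exists (gamma_seq z 1 * (1 + z)); intros y [n ->].
  eapply Rle_trans; [|apply (bound n)]; unfold u.
  assert (n0 : 0 < INR (n + 1)) by (apply lt_0_INR; lia).
  assert (g0 := gamma_seq_pos z (n + 1) ltac:(lra) ltac:(lia)).
  rewrite <- (Rmult_1_r (gamma_seq z (n + 1))) at 1.
  apply Rmult_le_compat_l; [lra|].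
  replace ((INR (n + 1) + z) / INR (n + 1)) with (1 + z / INR (n + 1)) by (field; lra).
  assert (0 < z / INR (n + 1)) by (apply Rdiv_lt_0_compat; lra). lra. }
exists l; split.
- apply Rlt_le_trans with (u 0%nat); [apply gamma_seq_pos; simpl; [lra|lia]|].
  apply growing_ineq; auto.
- apply (CV_shift _ 1), Hl.
Qed.

Lemma gamma_cv_pos z : 0 < z -> exists l, 0 < l /\ Un_cv (gamma_seq z) l.
Proof.
intros z0; destruct (INR_unbounded z) as [N HN].
assert (H : 0 < z <= INR N + 1) by lra; clear z0 HN.
revert z H; induction N as [|N IH]; intros z Hz.
{ apply gamma_cv_unit; simpl in Hz; lra. }
destruct (Rle_lt_dec z 1) as [le|lt]; [apply gamma_cv_unit; lra|].
destruct (IH (z - 1)) as [l [l0 Hl]]; [rewrite S_INR in Hz; lra|].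
exists ((z - 1) * l); split; [apply Rmult_lt_0_compat; lra|].
apply (Un_cv_ext_pos (fun n => (z - 1) * gamma_seq (z - 1) n *
   ((INR n + 0) / (INR n + (z - 1 + 1))))).
{ intros n Hn; rewrite <- gamma_seq_succ; auto; [f_equal; ring|apply not_pole_pos; lra]. }
rewrite <- (Rmult_1_r ((z - 1) * l)).
apply (CV_mult (fun n => (z - 1) * gamma_seq (z - 1) n)); [|apply ratio_cv].
apply (CV_mult (fun _ => z - 1)); [|exact Hl].
intros e e0; exists 0%nat; intros; rewrite Rdist_eq; exact e0.
Qed.

Lemma gamma_cv z : not_pole z -> exists l, l <> 0 /\ Un_cv (gamma_seq z) l.
Proof.
intros np; destruct (INR_unbounded (- z)) as [N HN].
assert (H : - z < INR N) by lra; clear HN.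
revert z np H; induction N as [|N IH]; intros z np Hz.
{ destruct (gamma_cv_pos z) as [l [l0 Hl]]; [simpl in Hz; lra|].
  exists l; split; [lra|exact Hl]. }
rewrite S_INR in Hz.
destruct (IH (z + 1)) as [l [l0 Hl]]; [apply not_pole_succ, np|lra|].
assert (z0 := np 0%nat); simpl in z0.
exists (/ z * l); split.
{ apply Rmult_integral_contrapositive_currified; [apply Rinv_neq_0_compat; lra|auto]. }
apply (Un_cv_ext_pos (fun n => / z * gamma_seq (z + 1) n *
   ((INR n + (z + 1)) / (INR n + 0)))).
{ intros n Hn; rewrite gamma_seq_succ by auto.
  assert (0 < INR n) by (apply lt_0_INR; lia).
  assert (N3 : INR n + (z + 1) <> 0).
  { specialize (np (S n)); rewrite S_INR in np; lra. }
  field; repeat split; auto; lra. }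
rewrite <- (Rmult_1_r (/ z * l)).
apply (CV_mult (fun n => / z * gamma_seq (z + 1) n)); [|apply ratio_cv].
apply (CV_mult (fun _ => / z)); [|exact Hl].
intros e e0; exists 0%nat; intros; rewrite Rdist_eq; exact e0.
Qed.

(** [Gamma] is chosen by [epsilon], so convergence must come before its nonvanishing and its
    functional equation. *)
Lemma Gamma_cv z : not_pole z -> Un_cv (gamma_seq z) (Gamma z).
Proof.
intros np; destruct (gamma_cv z np) as [l [_ Hl]].
exact (epsilon_spec (inhabits 0) (fun l => Un_cv (gamma_seq z) l) (ex_intro _ l Hl)).
Qed.

Lemma Gamma_neq_0 z : not_pole z -> Gamma z <> 0.
Proof.
intros np; destruct (gamma_cv z np) as [l [l0 Hl]].
rewrite (UL_sequence _ _ _ (Gamma_cv z np) Hl); exact l0.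
Qed.

Lemma Gamma_succ z : not_pole z -> Gamma (z + 1) = z * Gamma z.
Proof.
intros np.
apply (UL_sequence (gamma_seq (z + 1))); [apply Gamma_cv, not_pole_succ, np|].
apply (Un_cv_ext_pos (fun n => z * gamma_seq z n * ((INR n + 0) / (INR n + (z + 1))))).
{ intros n Hn; rewrite <- gamma_seq_succ; auto. }
rewrite <- (Rmult_1_r (z * Gamma z)).
apply (CV_mult (fun n => z * gamma_seq z n)); [|apply ratio_cv].
apply (CV_mult (fun _ => z)); [|apply Gamma_cv, np].
intros e e0; exists 0%nat; intros; rewrite Rdist_eq; exact e0.
Qed.

(** * Consequences of admissibility *)

(** The factors that H(n) and H(n+1) jointly contribute, for z = n+b+1 and for z = -(n+a+1). The
    pair belonging to f is negative exactly when f < z < f + 1. *)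
Fixpoint crossing (F : list nat) (z : R) : R :=
  match F with
  | [] => 1
  | f :: F' => (z - INR f) * (z - 1 - INR f) * crossing F' z
  end.

Definition off_lattice (F : list nat) (z : R) : Prop :=
  z <> 0 /\ forall f, In f F -> z <> INR f /\ z <> INR f + 1.

Lemma floor_sign j z1 z2 f :
  IZR j <= z1 < IZR j + 1 -> IZR j <= z2 < IZR j + 1 ->
  z1 <> INR f -> z2 <> INR f -> 0 < (z1 - INR f) * (z2 - INR f).
Proof.
rewrite INR_IZR_INZ; intros H1 H2 n1 n2.
destruct (Z_le_gt_dec (Z.of_nat f) j) as [le|gt].
- apply IZR_le in le; apply Rmult_lt_0_compat; lra.
- assert (le : (j + 1 <= Z.of_nat f)%Z) by lia.
  apply IZR_le in le; rewrite plus_IZR in le; nra.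
Qed.

(** Off the lattice, the signs of z, z - f and z - 1 - f depend only on the integer part of z. *)
Lemma floor_crossing F j z1 z2 :
  IZR j <= z1 < IZR j + 1 -> IZR j <= z2 < IZR j + 1 ->
  off_lattice F z1 -> off_lattice F z2 ->
  0 < (z1 * crossing F z1) * (z2 * crossing F z2).
Proof.
intros H1 H2 [n1 o1] [n2 o2].
assert (P : 0 < z1 * z2).
{ assert (Q := floor_sign j z1 z2 0 H1 H2); simpl in Q; rewrite !Rminus_0_r in Q; auto. }
assert (C : 0 < crossing F z1 * crossing F z2).
{ clear P; induction F as [|f F IH]; simpl; [lra|].
  assert (C := IH (fun g Hg => o1 g (or_intror Hg)) (fun g Hg => o2 g (or_intror Hg))).
  destruct (o1 f (or_introl eq_refl)), (o2 f (or_introl eq_refl)).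
  assert (A := floor_sign j z1 z2 f H1 H2 H H3).
  assert (B := floor_sign (j - 1) (z1 - 1) (z2 - 1) f).
  rewrite minus_IZR in B.
  specialize (B ltac:(lra) ltac:(lra) ltac:(lra) ltac:(lra)).
  assert (D := Rmult_lt_0_compat _ _ (Rmult_lt_0_compat _ _ A B) C). lra. }
assert (D := Rmult_lt_0_compat _ _ P C). lra.
Qed.

Lemma crossing_negative F z : z < 0 -> 0 < crossing F z.
Proof.
intros Hz; induction F as [|f F IH]; simpl; [lra|].
assert (P := pos_INR f); apply Rmult_lt_0_compat; auto; nra.
Qed.

Lemma crossing_sign F j z : NoDup F -> INR j <= z < INR j + 1 ->
  (forall f, In f F -> z <> INR f /\ z <> INR f + 1) ->
  (In j F -> crossing F z < 0) /\ (~ In j F -> 0 < crossing F z).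
Proof.
intros ND Hz o; induction F as [|f F IH]; simpl; [split; [tauto|lra]|].
inversion_clear ND.
destruct IH as [I1 I2]; auto.
{ intros g Hg; apply o; simpl; auto. }
destruct (o f (or_introl eq_refl)) as [o1 o2].
destruct (Nat.eq_dec f j) as [->|ne].
- split; [intros _|tauto]; specialize (I2 H).
  assert ((z - INR j) * (z - 1 - INR j) < 0) by nra. nra.
- assert (P : 0 < (z - INR f) * (z - 1 - INR f)).
  { destruct (le_lt_dec f j) as [le|lt].
    - assert (L : (S f <= j)%nat) by lia; apply le_INR in L; rewrite S_INR in L.
      apply Rmult_lt_0_compat; lra.
    - assert (L : (S j <= f)%nat) by lia; apply le_INR in L; rewrite S_INR in L; nra. }
  split; intros Hj.
  + assert (crossing F z < 0) by (apply I1; tauto). nra.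
  + assert (0 < crossing F z) by (apply I2; tauto). nra.
Qed.

Lemma nat_floor t : 0 <= t -> exists n, INR n <= t < INR n + 1.
Proof.
intros t0; destruct (INR_unbounded t) as [N HN].
induction N as [|N IH]; [simpl in HN; lra|].
rewrite S_INR in HN; destruct (Rle_lt_dec (INR N) t); [exists N; lra|auto].
Qed.

Lemma int_floor t : exists j : Z, IZR j <= t < IZR j + 1.
Proof. exists (up t - 1)%Z; destruct (archimed t); rewrite minus_IZR; lra. Qed.

Section Signs.

Variables (F : list nat) (a b : R).
Hypothesis (a_ok : forall n, INR n + a + 1 <> 0).
Hypothesis (b_ok : forall n, INR n + b + 1 <> 0).
Hypothesis (ab_ok : forall n, INR n + a + b + 1 <> 0).
Hypothesis (F_ok : forall f n, In f F -> INR n + b - INR f <> 0).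
Hypothesis (H_pos : forall n, 0 <= Hfun a b F (INR n)).

Let prodF (x : R) : R :=
  fold_right (fun f acc => (x + b - INR f) * (x + INR f + a + 1) * acc) 1 F.

Lemma prodF_crossing n :
  prodF (INR n) * prodF (INR (S n)) =
  crossing F (INR n + b + 1) * crossing F (- (INR n + a + 1)).
Proof.
unfold prodF; rewrite S_INR; clear.
induction F as [|f G IH]; simpl; [ring|].
transitivity ((INR n + b - INR f) * (INR n + INR f + a + 1) *
  ((INR n + 1 + b - INR f) * (INR n + 1 + INR f + a + 1)) *
  (crossing G (INR n + b + 1) * crossing G (- (INR n + a + 1)))); [rewrite <- IH|]; ring.
Qed.

Lemma prodF_neq_0 n : prodF (INR n) <> 0.
Proof.
unfold prodF; revert F_ok; clear - a_ok; intros F_ok.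
induction F as [|f G IH]; simpl; [lra|].
repeat apply Rmult_integral_contrapositive_currified.
- apply F_ok; simpl; auto.
- assert (Q := a_ok (n + f)); rewrite plus_INR in Q; lra.
- apply IH; intros; apply F_ok; simpl; auto.
Qed.

(** By the functional equation H(n) H(n+1) is a square times this expression, and no factor
    vanishes. Writing the part with a in terms of -(n+a+1) gives both main factors the form z *
    crossing F z. *)
Lemma admissible_sign n :
  0 < - ((INR n + b + 1) * crossing F (INR n + b + 1)) *
      (- (INR n + a + 1) * crossing F (- (INR n + a + 1))) *
      ((2 * INR n + a + b + 1) * (2 * INR n + a + b + 3) * (INR n + a + b + 1)).
Proof.
assert (pa : not_pole (INR n + a + 1)).
{ intros m E; apply (a_ok (n + m)); rewrite plus_INR; lra. }
assert (pb : not_pole (INR n + b + 1)).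
{ intros m E; apply (b_ok (n + m)); rewrite plus_INR; lra. }
assert (ps : not_pole (INR n + a + b + 1)).
{ intros m E; apply (ab_ok (n + m)); rewrite plus_INR; lra. }
assert (d1 : 2 * INR n + a + b + 1 <> 0).
{ assert (Q := ab_ok (n + n)); rewrite plus_INR in Q; lra. }
assert (d3 : 2 * INR n + a + b + 3 <> 0).
{ assert (Q := ab_ok (n + S (S n))); rewrite plus_INR, !S_INR in Q; lra. }
assert (ga := Gamma_neq_0 _ pa); assert (gb := Gamma_neq_0 _ pb).
assert (gs := Gamma_neq_0 _ ps).
assert (a1 := a_ok n); assert (b1 := b_ok n); assert (s1 := ab_ok n).
assert (h0 := H_pos n); assert (h1 := H_pos (S n)).
assert (p0 := prodF_neq_0 n); assert (p1 := prodF_neq_0 (S n)).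
assert (pc := prodF_crossing n).
unfold Hfun in h0, h1; fold (prodF (INR n)) in h0; fold (prodF (INR (S n))) in h1.
rewrite S_INR in h1, p1, pc.
replace (INR n + 1 + a + 1) with (INR n + a + 1 + 1) in h1 by ring.
replace (INR n + 1 + b + 1) with (INR n + b + 1 + 1) in h1 by ring.
replace (INR n + 1 + a + b + 1) with (INR n + a + b + 1 + 1) in h1 by ring.
rewrite (Gamma_succ _ pa), (Gamma_succ _ pb), (Gamma_succ _ ps) in h1.
set (A := INR n + a + 1) in *; set (B := INR n + b + 1) in *.
set (S1 := INR n + a + b + 1) in *; set (D1 := 2 * INR n + a + b + 1) in *.
replace (2 * (INR n + 1) + a + b + 1) with (2 * INR n + a + b + 3) in h1 by ring.
set (D3 := 2 * INR n + a + b + 3) in *.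
set (GA := Gamma A) in *; set (GB := Gamma B) in *; set (GS := Gamma S1) in *.
assert (h := Rmult_le_pos _ _ h0 h1).
set (w := GA * GB / (GS * D1 * D3 * S1)) in *.
assert (w0 : w <> 0).
{ unfold w, Rdiv; repeat apply Rmult_integral_contrapositive_currified; auto.
  apply Rinv_neq_0_compat; repeat apply Rmult_integral_contrapositive_currified; auto. }
assert (w2 : 0 < w * w) by nra.
set (K := - (B * crossing F B) * (- A * crossing F (- A)) * (D1 * D3 * S1)).
assert (E : prodF (INR n) * (GA * GB / (D1 * GS)) *
    (prodF (INR n + 1) * (A * GA * (B * GB) / (D3 * (S1 * GS)))) = w * w * K).
{ transitivity ((prodF (INR n) * prodF (INR n + 1)) *
    ((GA * GB / (D1 * GS)) * (A * GA * (B * GB) / (D3 * (S1 * GS))))); [ring|].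
  rewrite pc; unfold w, K; field; auto. }
rewrite E in h.
assert (K0 : K <> 0).
{ intros K0; rewrite K0, Rmult_0_r in E.
  revert E; repeat apply Rmult_integral_contrapositive_currified; auto;
  apply Rinv_neq_0_compat; repeat apply Rmult_integral_contrapositive_currified; auto. }
nra.
Qed.

Lemma off_lattice_b n : off_lattice F (INR n + b + 1).
Proof.
split; [auto|]; intros f Hf.
assert (Q := F_ok f n Hf); assert (Q' := F_ok f (S n) Hf); rewrite S_INR in Q'; lra.
Qed.

Lemma off_lattice_a n : off_lattice F (- (INR n + a + 1)).
Proof.
assert (Q0 := a_ok n); split; [lra|]; intros f Hf.
assert (Q := a_ok (n + f)); assert (Q' := a_ok (n + S f)).
rewrite plus_INR in *; rewrite S_INR in Q'; lra.
Qed.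

(* The sum [a + b] changes the sign of [2 n + a + b + 1] at a single [n]; there the
   lattice cells of [n + b + 1] and [- (n + a + 1)] agree or are adjacent, and in the
   latter case moving [n] by one step exchanges them. *)
Lemma ab_gt_m2 : -2 < a + b.
Proof.
apply Rnot_le_lt; intros s2.
assert (s2' : a + b <> -2) by (assert (Q := ab_ok 1); simpl in Q; lra).
destruct (nat_floor (- (a + b + 1) / 2)) as [n Hn]; [lra|].
assert (d1 : 2 * INR n + a + b + 1 < 0).
{ assert (Q := ab_ok (n + n)); rewrite plus_INR in Q; lra. }
assert (d3 : 0 < 2 * INR n + a + b + 3) by lra.
assert (n0 := pos_INR n).
assert (s1 : INR n + a + b + 1 < 0).
{ destruct n as [|n]; [simpl in *; lra|]; rewrite S_INR in *.
  assert (P := pos_INR n); lra. }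
set (Z := fun z => z * crossing F z).
assert (P : 0 < Z (INR n + b + 1) * Z (- (INR n + a + 1)) * -1).
{ assert (Q := admissible_sign n); unfold Z.
  set (u := (INR n + b + 1) * _) in *; set (v := - (INR n + a + 1) * _) in *.
  assert (0 < (2 * INR n + a + b + 1) * (2 * INR n + a + b + 3) * (INR n + a + b + 1)).
  { assert ((2 * INR n + a + b + 1) * (2 * INR n + a + b + 3) < 0) by nra. nra. }
  nra. }
destruct (int_floor (INR n + b + 1)) as [i Hi].
destruct (int_floor (- (INR n + a + 1))) as [j Hj].
assert (ij : (i = j \/ i = j + 1 \/ j = i + 1)%Z).
{ assert (IZR i < IZR (j + 2)) by (rewrite plus_IZR; lra).
  assert (IZR j < IZR (i + 2)) by (rewrite plus_IZR; lra).
  apply lt_IZR in H, H0; lia. }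
destruct ij as [ij|[ij|ij]]; subst.
- assert (Q := floor_crossing F j _ _ Hi Hj (off_lattice_b n) (off_lattice_a n)).
  unfold Z in P; lra.
- rewrite plus_IZR in Hi.
  destruct n as [|n].
  { simpl in *; lra. }
  rewrite S_INR in *.
  assert (Q := admissible_sign n).
  assert (Q1 : 0 < Z (INR n + b + 1) * Z (- (INR n + 1 + a + 1))).
  { apply (floor_crossing F j); try lra; [apply off_lattice_b|].
    rewrite <- S_INR; apply off_lattice_a. }
  assert (Q2 : 0 < Z (- (INR n + a + 1)) * Z (INR n + 1 + b + 1)).
  { apply (floor_crossing F (j + 1)); rewrite ?plus_IZR; try lra; [apply off_lattice_a|].
    rewrite <- S_INR; apply off_lattice_b. }
  fold (Z (INR n + b + 1)) in Q; fold (Z (- (INR n + a + 1))) in Q.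
  assert (K : (2 * INR n + a + b + 1) * (2 * INR n + a + b + 3) * (INR n + a + b + 1) < 0).
  { assert (0 < (2 * INR n + a + b + 1) * (2 * INR n + a + b + 3)) by nra. nra. }
  assert (Q3 : 0 < Z (INR n + b + 1) * Z (- (INR n + a + 1))) by nra.
  assert (R1 := Rmult_lt_0_compat _ _ Q1 Q2); assert (R2 := Rmult_lt_0_compat _ _ Q3 P).
  lra.
- rewrite plus_IZR in Hj.
  assert (Q := admissible_sign (S n)); rewrite S_INR in Q.
  assert (Q1 : 0 < Z (INR n + 1 + b + 1) * Z (- (INR n + a + 1))).
  { apply (floor_crossing F (i + 1)); rewrite ?plus_IZR; try lra; [|apply off_lattice_a].
    rewrite <- S_INR; apply off_lattice_b. }
  assert (Q2 : 0 < Z (- (INR n + 1 + a + 1)) * Z (INR n + b + 1)).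
  { apply (floor_crossing F i); try lra; [|apply off_lattice_b].
    rewrite <- S_INR; apply off_lattice_a. }
  fold (Z (INR n + 1 + b + 1)) in Q; fold (Z (- (INR n + 1 + a + 1))) in Q.
  assert (K : (2 * (INR n + 1) + a + b + 1) * (2 * (INR n + 1) + a + b + 3)
     * (INR n + 1 + a + b + 1) < 0).
  { assert (INR n + 1 + a + b + 1 < 0).
    { destruct n as [|n]; [simpl in *; lra|]; rewrite S_INR in *.
      assert (P' := pos_INR n); lra. }
    assert (0 < (2 * (INR n + 1) + a + b + 1) * (2 * (INR n + 1) + a + b + 3)) by nra. nra. }
  assert (Q3 : 0 < Z (INR n + 1 + b + 1) * Z (- (INR n + 1 + a + 1))) by nra.
  assert (R1 := Rmult_lt_0_compat _ _ Q1 Q2); assert (R2 := Rmult_lt_0_compat _ _ Q3 P).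
  lra.
Qed.

(** Once a + b > -2, the last three factors in [admissible_sign] have a positive product; for n = 0
    the factor a + b + 1, whose sign is unknown, occurs twice. *)
Lemma crossing_opposite n :
  ((INR n + b + 1) * crossing F (INR n + b + 1)) *
  (- (INR n + a + 1) * crossing F (- (INR n + a + 1))) < 0.
Proof.
assert (Q := admissible_sign n).
set (u := (INR n + b + 1) * _) in *; set (v := - (INR n + a + 1) * _) in *.
assert (s2 := ab_gt_m2).
assert (K : 0 < (2 * INR n + a + b + 1) * (2 * INR n + a + b + 3) * (INR n + a + b + 1)).
{ destruct n as [|n].
  - assert (s1 := ab_ok 0); simpl in *.
    replace ((2 * 0 + a + b + 1) * (2 * 0 + a + b + 3) * (0 + a + b + 1)) with
      ((a + b + 3) * ((a + b + 1) * (a + b + 1))) by ring.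
    apply Rmult_lt_0_compat; [lra|nra].
  - rewrite S_INR; assert (P := pos_INR n).
    repeat apply Rmult_lt_0_compat; lra. }
nra.
Qed.

(** If b < -1 then a > -1, and at n = 0 both n+b+1 and -(n+a+1) are negative. Both crossings are
    then positive, against [crossing_opposite]. *)
Lemma b_gt_m1 : -1 < b.
Proof.
apply Rnot_le_lt; intros b1.
assert (b1' : b <> -1) by (assert (Q := b_ok 0); simpl in Q; lra).
assert (s2 := ab_gt_m2); assert (Q := crossing_opposite 0); simpl in Q.
assert (P1 := crossing_negative F (0 + b + 1) ltac:(lra)).
assert (P2 := crossing_negative F (- (0 + a + 1)) ltac:(lra)).
set (u := crossing F (0 + b + 1)) in *; set (v := crossing F (- (0 + a + 1))) in *.
assert (0 < u * v * ((b + 1) * - (a + 1))).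
{ apply Rmult_lt_0_compat; [apply Rmult_lt_0_compat; auto|nra]. }
lra.
Qed.

(** The integer part of n+b+1 is n+M. For n < m that of -(n+a+1) is m-1-n, and opposite crossing
    signs mean that exactly one of the two is in F. For n >= m the number -(n+a+1) is negative,
    which excludes n+M from F. *)
Lemma admissible_structure : NoDup F -> F <> [] -> exists m M : nat,
  (INR M - 1 <= b < INR M) /\ 0 < a + INR m + 1 /\ (m = 0%nat \/ a + INR m < 0) /\
  (m <= M)%nat /\ (1 <= M)%nat /\
  (forall n, (n < m)%nat -> (In (n + M)%nat F <-> ~ In (m - 1 - n)%nat F)) /\
  (forall n, (m <= n)%nat -> ~ In (n + M)%nat F).
Proof.
intros ND ne; assert (b1 := b_gt_m1); assert (s2 := ab_gt_m2).
destruct (nat_floor (b + 1)) as [M HM]; [lra|].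
assert (Hm : exists m, 0 < a + INR m + 1 /\ (m = 0%nat \/ a + INR m < 0)).
{ destruct (Rlt_le_dec (-1) a) as [gt|le].
  - exists 0%nat; simpl; split; [lra|auto].
  - destruct (nat_floor (- a)) as [m Hm]; [lra|].
    exists m; split; [lra|]; right.
    assert (m0 : (m <> 0)%nat) by (intros ->; simpl in *; lra).
    assert (Q := a_ok (m - 1)); rewrite minus_INR in Q by lia; simpl in Q; lra. }
destruct Hm as [m [Hm1 Hm2]].
exists m, M.
assert (Bs : forall n, (In (n + M)%nat F -> crossing F (INR n + b + 1) < 0) /\
   (~ In (n + M)%nat F -> 0 < crossing F (INR n + b + 1))).
{ intros n; apply crossing_sign; [auto|rewrite plus_INR; lra|apply off_lattice_b]. }
assert (C1 : forall n, (n < m)%nat -> (In (n + M)%nat F <-> ~ In (m - 1 - n)%nat F)).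
{ intros n Hn; destruct Hm2 as [->|Hm2]; [lia|].
  assert (Q := crossing_opposite n).
  assert (n0 := pos_INR n).
  destruct (crossing_sign F (m - 1 - n) (- (INR n + a + 1)) ND) as [A1 A2].
  { rewrite !minus_INR by lia; simpl; lra. }
  { apply off_lattice_a. }
  assert (nm : INR n + 1 <= INR m) by (rewrite <- S_INR; apply le_INR; lia).
  destruct (Bs n) as [B1 B2].
  set (u := crossing F (INR n + b + 1)) in *; set (v := crossing F (- (INR n + a + 1))) in *.
  assert (pp : 0 < (INR n + b + 1) * - (INR n + a + 1)) by (apply Rmult_lt_0_compat; lra).
  assert (uv : u * v < 0) by nra.
  split.
  - intros H1 H2; specialize (B1 H1); specialize (A1 H2); nra.
  - intros H2; specialize (A2 H2); apply NNPP; intros H1; specialize (B2 H1); nra. }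
assert (C2 : forall n, (m <= n)%nat -> ~ In (n + M)%nat F).
{ intros n Hn Hin; assert (Q := crossing_opposite n).
  apply le_INR in Hn; assert (n0 := pos_INR n).
  assert (A := crossing_negative F (- (INR n + a + 1)) ltac:(lra)).
  apply (Bs n) in Hin.
  set (u := crossing F (INR n + b + 1)) in *; set (v := crossing F (- (INR n + a + 1))) in *.
  assert (0 < (- u * v) * ((INR n + b + 1) * (INR n + a + 1))).
  { apply Rmult_lt_0_compat; [nra|]; apply Rmult_lt_0_compat; lra. }
  lra. }
(* The bound a + b > -2 only gives m <= M + 1. If M = m - 1, the pair for n = 0 is a single number,
   which would be in F exactly when it is not. *)
assert (mM : (m <= M)%nat).
{ destruct (Nat.eq_dec m 0) as [->|m0]; [lia|].
  destruct Hm2 as [|Hm2]; [lia|].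
  assert (L : INR m < INR (M + 2)) by (rewrite plus_INR; simpl; lra).
  apply INR_lt in L.
  destruct (Nat.eq_dec M (m - 1)) as [e|]; [|lia].
  assert (Q := C1 0%nat ltac:(lia)); simpl in Q; rewrite Nat.sub_0_r, <- e in Q; tauto. }
repeat split; auto; try lra.
- destruct M as [|M]; [|lia].
  exfalso; destruct F as [|f G]; [auto|].
  apply (C2 f); [lia|rewrite Nat.add_0_r; simpl; auto].
- apply C1, H.
- apply C1, H.
Qed.

End Signs.

(** * The order of the chain *)

Lemma gbinom_shift y n :
  gbinom (INR n + y) n * INR (fact n) = prodR n (fun i => y + INR (S i)).
Proof.
unfold gbinom.
transitivity (prodR n (fun i => INR n + y - INR i)); [field; apply INR_fact_neq_0|].
induction n as [|n IH]; [auto|].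
rewrite prodR_shift; change (INR 0) with 0.
rewrite (prodR_ext n _ (fun i => INR n + y - INR i)) by (intros; rewrite !S_INR; ring).
rewrite IH; cbn [prodR]; rewrite S_INR; ring.
Qed.

Lemma jacobi_end_product a b n :
  (ev (jacobiE a (- b) n) (-1) * ev (jacobiE a (- b) n) 1) * (INR (fact n) * INR (fact n)) =
  prodR n (fun i => (a + INR (S i)) * (b - INR (S i))).
Proof.
rewrite !ev_jacobiE, jacobiP_at_1, jacobiP_at_m1.
transitivity ((-1) ^ n * (gbinom (INR n + - b) n * INR (fact n)) *
  (gbinom (INR n + a) n * INR (fact n))); [ring|].
rewrite !gbinom_shift.
induction n as [|n IH]; [simpl; ring|].
change (prodR (S n) (fun i => (a + INR (S i)) * (b - INR (S i)))) with
  (prodR n (fun i => (a + INR (S i)) * (b - INR (S i))) * ((a + INR (S n)) * (b - INR (S n)))).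
rewrite <- IH; cbn [prodR]; simpl ((-1) ^ S n); ring.
Qed.

(** Counts the negative factors in [jacobi_end_product]: a + i for i <= m and b - i for M <= i <= f.
    Truncated subtraction makes the second count 0 when f < M. *)
Definition end_sign (m M f : nat) : nat := (min f m + (S f - M))%nat.

Lemma end_product_sign a b m M n :
  INR M - 1 <= b < INR M -> 0 < a + INR m + 1 -> (m = 0%nat \/ a + INR m < 0) ->
  (1 <= M)%nat -> (forall i, (1 <= i <= n)%nat -> b <> INR i) ->
  0 < (-1) ^ end_sign m M n * (ev (jacobiE a (- b) n) (-1) * ev (jacobiE a (- b) n) 1).
Proof.
intros Hb Hm1 Hm2 M1 Hn.
assert (P := INR_fact_pos n).
apply Rmult_lt_reg_r with (INR (fact n) * INR (fact n)); [apply Rmult_lt_0_compat; auto|].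
rewrite Rmult_0_l, Rmult_assoc, jacobi_end_product; clear P.
unfold end_sign; induction n as [|n IH].
{ replace (min 0 m + (1 - M))%nat with 0%nat by lia; simpl; lra. }
specialize (IH (fun i Hi => Hn i ltac:(lia))).
change (prodR (S n) (fun i => (a + INR (S i)) * (b - INR (S i)))) with
  (prodR n (fun i => (a + INR (S i)) * (b - INR (S i))) * ((a + INR (S n)) * (b - INR (S n)))).
set (p := prodR n _) in *.
assert (bn := Hn (S n) ltac:(lia)).
assert (Sa : (S n <= m)%nat /\ a + INR (S n) < 0 \/ (m <= n)%nat /\ 0 < a + INR (S n)).
{ destruct (le_lt_dec (S n) m) as [le|lt].
  - left; split; [auto|]; destruct Hm2; [lia|apply le_INR in le; lra].
  - right; split; [lia|]; assert (L : (m <= n)%nat) by lia; apply le_INR in L; rewrite S_INR; lra. }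
assert (Sb : (S n < M)%nat /\ 0 < b - INR (S n) \/ (M <= S n)%nat /\ b - INR (S n) < 0).
{ destruct (le_lt_dec M (S n)) as [le|lt].
  - right; split; [auto|]; apply le_INR in le; lra.
  - left; split; [auto|]; assert (L : (S (S n) <= M)%nat) by lia.
    apply le_INR in L; rewrite (S_INR (S n)) in L; lra. }
set (u := a + INR (S n)) in *; set (w := b - INR (S n)) in *.
set (e := (min n m + (S n - M))%nat) in *.
destruct Sa as [[La Sa]|[La Sa]], Sb as [[Lb Sb]|[Lb Sb]].
- replace (min (S n) m + (S (S n) - M))%nat with (S e) by (unfold e; lia); simpl pow.
  assert (0 < - u * w) by nra.
  assert (Q := Rmult_lt_0_compat _ _ IH H); lra.
- replace (min (S n) m + (S (S n) - M))%nat with (S (S e)) by (unfold e; lia); simpl pow.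
  assert (0 < u * w) by nra.
  assert (Q := Rmult_lt_0_compat _ _ IH H); lra.
- replace (min (S n) m + (S (S n) - M))%nat with e by (unfold e; lia).
  assert (0 < u * w) by nra.
  assert (Q := Rmult_lt_0_compat _ _ IH H); lra.
- replace (min (S n) m + (S (S n) - M))%nat with (S e) by (unfold e; lia); simpl pow.
  assert (0 < u * - w) by nra.
  assert (Q := Rmult_lt_0_compat _ _ IH H); lra.
Qed.

Lemma sumR_pos n f i : (i < n)%nat -> (forall j, (j < n)%nat -> 0 <= f j) -> 0 < f i ->
  0 < sumR n f.
Proof.
intros Hi nn p; induction n as [|n IH]; [lia|simpl].
assert (N : 0 <= sumR n f).
{ clear - nn; induction n as [|n IH]; simpl; [lra|].
  assert (0 <= f n) by (apply nn; lia).
  assert (0 <= sumR n f) by (apply IH; intros; apply nn; lia). lra. }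
destruct (Nat.eq_dec i n) as [->|]; [lra|].
assert (0 < sumR n f) by (apply IH; [lia|intros; apply nn; lia]).
assert (0 <= f n) by (apply nn; lia). lra.
Qed.

Lemma prodR_pos n f : (forall j, (j < n)%nat -> 0 < f j) -> 0 < prodR n f.
Proof.
induction n; simpl; intros H; [lra|].
apply Rmult_lt_0_compat; [apply IHn; intros; apply H; lia|apply H; lia].
Qed.

Lemma gbinom_pos y j : INR j < y + 1 -> 0 < gbinom y j.
Proof.
intros H; unfold gbinom; apply Rdiv_lt_0_compat; [|apply INR_fact_pos].
apply prodR_pos; intros i Hi; assert (L : (S i <= j)%nat) by lia.
apply le_INR in L; rewrite S_INR in L; lra.
Qed.

Lemma gbinom_neg_sign y j : y < 0 -> 0 < (-1) ^ j * gbinom y j.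
Proof.
intros H; unfold gbinom, Rdiv; rewrite <- Rmult_assoc.
apply Rdiv_lt_0_compat; [|apply INR_fact_pos].
induction j as [|j IH]; simpl; [lra|].
assert (P := pos_INR j).
replace (-1 * (-1) ^ j * (prodR j (fun i => y - INR i) * (y - INR j))) with
  ((-1) ^ j * prodR j (fun i => y - INR i) * (INR j - y)) by ring.
apply Rmult_lt_0_compat; lra.
Qed.

(* For [a > -1] and [f < b] all the coefficients in the basis
   [(1 - x) ^ (f - j) * (1 + x) ^ j] are positive. *)
Lemma jacobi_positive a b f : -1 < a -> INR f < b -> nonzero_on (jacobiE a (- b) f).
Proof.
intros a1 fb x Hx; rewrite ev_jacobiE; unfold jacobiP.
assert (two : 0 < / 2 ^ f) by (apply Rinv_0_lt_compat, pow_lt; lra).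
rewrite (sumR_ext (S f) _ (fun j => gbinom (INR f + a) j *
  ((-1) ^ (f - j) * gbinom (INR f + - b) (f - j)) * ((1 - x) ^ (f - j) * (x + 1) ^ j))).
2: { intros j Hj; replace (x - 1) with ((-1) * (1 - x)) by ring.
  rewrite Rpow_mult_distr; ring. }
set (t := fun j => _).
assert (c : forall j, (j < S f)%nat -> 0 < gbinom (INR f + a) j *
  ((-1) ^ (f - j) * gbinom (INR f + - b) (f - j))).
{ intros j Hj; apply Rmult_lt_0_compat; [apply gbinom_pos|apply gbinom_neg_sign; lra].
  assert (L : (j <= f)%nat) by lia; apply le_INR in L; lra. }
assert (nn : forall j, (j < S f)%nat -> 0 <= t j).
{ intros j Hj; apply Rmult_le_pos; [left; apply c, Hj|].
  apply Rmult_le_pos; apply pow_le; lra. }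
assert (0 < sumR (S f) t).
{ destruct (Req_dec x (-1)) as [->|n].
  - apply (sumR_pos _ _ 0%nat); [lia|exact nn|].
    apply Rmult_lt_0_compat; [apply c; lia|].
    apply Rmult_lt_0_compat; [apply pow_lt; lra|simpl; lra].
  - apply (sumR_pos _ _ f); [lia|exact nn|].
    apply Rmult_lt_0_compat; [apply c; lia|].
    rewrite Nat.sub_diag; apply Rmult_lt_0_compat; [simpl; lra|apply pow_lt; lra]. }
assert (Q := Rmult_lt_0_compat _ _ two H); lra.
Qed.

(* [p] is the derivative of a multiple of [(1 - x ^ 2) * p' + T * p], to which
   the convexity argument applies. *)
Lemma jacobi_no_zero a c n : a + c + INR n < 0 ->
  0 < ev (jacobiE a c n) (-1) * ev (jacobiE a c n) 1 -> nonzero_on (jacobiE a c n).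
Proof.
intros neg p x Hx.
assert (ode := jacobi_ode a c n).
assert (reg : forall y, defined_at y (jacobiE a c n)) by (intros; apply defined_at_jacobiE).
set (y := jacobiE a c n) in *; clearbody y.
(* By the equation, (1 - x^2) p' + T p has derivative -(n (n+a+c+1) + a + c) p, and the bracket
   factors as (n+1)(n+a+c). *)
set (delta := - (INR n + 1) * (a + c + INR n)).
assert (d0 : 0 < delta).
{ unfold delta; assert (P := pos_INR n); nra. }
set (T := Add (Cst (c - a)) (Mul (Cst (- (a + c))) Var)).
set (r := Mul (Cst (/ delta)) (Add (Mul (Add (Cst 1) (Mul (Cst (-1)) (Mul Var Var))) (der y))
  (Mul T y))).
apply (second_order_no_critical (ev T) (ev r) (ev y) (ev (der y)) delta); auto.
- intros; apply continuity_ev; simpl; auto.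
- intros z Hz; eapply derivable_pt_lim_eq.
  + apply derivable_ev; assert (Q := reg z); assert (Q' := defined_at_der _ _ Q).
    simpl; tauto.
  + specialize (ode z); simpl.
    apply Rmult_eq_reg_l with delta; [|lra].
    transitivity ((1 - z ^ 2) * ev (der (der y)) z + (c - a - (a + c + 2) * z) * ev (der y) z
      - (a + c) * ev y z); [field; lra|].
    unfold delta; lra.
- intros z Hz; apply derivable_ev, reg.
- intros z Hz; simpl; field; lra.
Qed.

Lemma eigenvalue_diff a c g f :
  jacobi_eigenvalue a c g - jacobi_eigenvalue a c f =
  (INR g - INR f) * (INR g + INR f + a + c + 1).
Proof. unfold jacobi_eigenvalue; ring. Qed.

(** The product of the two end relations is 4 A C v(-1) v(1) = -d^2 y(-1) y(1), so each step
    reverses the sign as long as A C > 0. *)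
Lemma chain_end_signs a c l f : admissible_chain a c l ->
  (forall g, In g l -> jacobi_eigenvalue a c f <> jacobi_eigenvalue a c g) ->
  (forall i, (i < length l)%nat -> 0 < (a + 1 + INR i) * (c + 1 + INR i)) ->
  forall e, 0 < (-1) ^ e * (ev (jacobiE a c f) (-1) * ev (jacobiE a c f) 1) ->
  0 < (-1) ^ (e + length l) * (ev (chain a c l f) (-1) * ev (chain a c l f) 1).
Proof.
induction l as [|g l IH]; intros H ne pos e He.
{ simpl; rewrite Nat.add_0_r; exact He. }
assert (H' := H); destruct H' as [_ H'].
specialize (IH H' (fun h Hh => ne h (or_intror Hh)) (fun i Hi => pos i (Nat.lt_lt_succ_r _ _ Hi)) e He).
assert (E1 := chain_at_1 a c l g f H); assert (E2 := chain_at_m1 a c l g f H).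
specialize (pos (length l) (Nat.lt_succ_diag_r _)).
specialize (ne g (or_introl eq_refl)).
cbn [length]; replace (e + S (length l))%nat with (S (e + length l)) by lia; simpl pow.
set (v := chain a c (g :: l) f) in *; set (y := chain a c l f) in *; clearbody v y.
set (s := (-1) ^ (e + length l)) in *; clearbody s.
set (d := jacobi_eigenvalue a c f - jacobi_eigenvalue a c g) in *.
assert (d2 : 0 < d * d).
{ assert (d <> 0) by (unfold d; lra). nra. }
set (A := a + 1 + INR (length l)) in *; set (C := c + 1 + INR (length l)) in *.
apply Rmult_lt_reg_l with (4 * (A * C)); [lra|].
rewrite Rmult_0_r.
replace (4 * (A * C) * (-1 * s * (ev v (-1) * ev v 1))) with
  (- s * ((2 * A * ev v 1) * (2 * C * ev v (-1)))) by ring.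
rewrite E1, E2.
replace (- s * (d * ev y 1 * (- d * ev y (-1)))) with
  (d * d * (s * (ev y (-1) * ev y 1))) by ring.
apply Rmult_lt_0_compat; auto.
Qed.

(** The first criterion reproduces its own hypotheses: the remaining functions stay free of zeros
    and a + 1 + n grows, so they may come in any order. *)
Lemma chain_extend a c rem : forall L, admissible_chain a c L ->
  (forall f, In f rem -> nonzero_on (chain a c L f)) -> NoDup rem ->
  (forall f g, In f rem -> In g rem -> f <> g ->
     jacobi_eigenvalue a c f <> jacobi_eigenvalue a c g) ->
  0 < a + 1 + INR (length L) -> admissible_chain a c (rev rem ++ L).
Proof.
induction rem as [|g rem IH]; intros L H nz ND ne p; [exact H|].
inversion_clear ND; simpl; rewrite <- app_assoc; simpl.
assert (H2 : admissible_chain a c (g :: L)) by (split; [apply nz; simpl; auto|exact H]).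
apply IH; auto.
- intros f Hf; apply chain_step_monotone; auto; [apply nz; simpl; auto|].
  apply ne; simpl; auto; intros ->; contradiction.
- intros f h Hf Hh; apply ne; simpl; auto.
- cbn [length]; rewrite S_INR; lra.
Qed.

Section Ordering.

Variables (F : list nat) (a b : R) (m M : nat).
Hypothesis (ND : NoDup F).
Hypothesis (F_pos : forall f, In f F -> (0 < f)%nat).
Hypothesis (F_ok : forall f n, In f F -> INR n + b - INR f <> 0).
Hypothesis (ab_ok : forall n, a - b <> - INR (S n)).
Hypothesis (b_cell : INR M - 1 <= b < INR M).
Hypothesis (a_low : 0 < a + INR m + 1).
Hypothesis (a_up : m = 0%nat \/ a + INR m < 0).
Hypothesis (mM : (m <= M)%nat).
Hypothesis (M_pos : (1 <= M)%nat).
Hypothesis (paired : forall n, (n < m)%nat -> (In (n + M)%nat F <-> ~ In (m - 1 - n)%nat F)).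
Hypothesis (bounded : forall n, (m <= n)%nat -> ~ In (n + M)%nat F).

Let N : nat := (M + m - 1)%nat.
Let Lam := jacobi_eigenvalue a (- b).

(** For i < m, the representative in F of the pair {i, N - i}. *)
Definition core (i : nat) : nat := if in_dec Nat.eq_dec i F then i else N - i.

Lemma core_cases i : core i = i \/ core i = (N - i)%nat.
Proof. unfold core; destruct in_dec; auto. Qed.

Lemma core_In i : (i < m)%nat -> In (core i) F.
Proof.
intros Hi; unfold core; destruct in_dec as [|n]; [auto|].
replace (N - i)%nat with (m - 1 - i + M)%nat by (unfold N; lia).
apply paired; [lia|]; replace (m - 1 - (m - 1 - i))%nat with i by lia; exact n.
Qed.

Lemma F_cases f : In f F -> (exists i, (i < m)%nat /\ core i = f) \/ (m <= f < M)%nat.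
Proof.
intros Hf; destruct (le_lt_dec m f) as [le|lt].
- destruct (le_lt_dec M f) as [le'|lt']; [|auto].
  left; destruct (le_lt_dec m (f - M)) as [lm|lm].
  { exfalso; apply (bounded (f - M) lm); replace (f - M + M)%nat with f by lia; auto. }
  exists (m - 1 - (f - M))%nat; split; [lia|].
  unfold core; destruct in_dec as [i|].
  + exfalso; revert i; apply paired; [auto|]; replace (f - M + M)%nat with f by lia; auto.
  + unfold N; lia.
- left; exists f; split; [auto|]; unfold core; destruct in_dec; tauto.
Qed.

Lemma core_injective i j : (i < m)%nat -> (j < m)%nat -> core i = core j -> i = j.
Proof.
intros Hi Hj; unfold core, N; destruct in_dec, in_dec; lia.
Qed.

Definition ordering : list nat :=
  map core (seq 0 m) ++ filter (fun f => andb (m <=? f) (f <? M))%nat F.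

Lemma middle_In f : In f (filter (fun f => andb (m <=? f) (f <? M))%nat F) <->
  In f F /\ (m <= f < M)%nat.
Proof.
rewrite filter_In, Bool.andb_true_iff, Nat.leb_le, Nat.ltb_lt; tauto.
Qed.

Lemma core_outside i : (i < m)%nat -> ~ (m <= core i < M)%nat.
Proof. intros Hi; destruct (core_cases i) as [->| ->]; unfold N; lia. Qed.

Lemma ordering_permutation : Permutation ordering F.
Proof.
unfold ordering; apply NoDup_Permutation; [|exact ND|].
- apply NoDup_app.
  + apply Injective_map_NoDup_in; [|apply seq_NoDup].
    intros i j Hi Hj; rewrite in_seq in Hi, Hj; apply core_injective; lia.
  + apply NoDup_filter, ND.
  + intros f Hf; rewrite middle_In; apply in_map_iff in Hf; destruct Hf as [i [<- Hi]].
    rewrite in_seq in Hi; intros [_ H]; revert H; apply core_outside; lia.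
- intros f; rewrite in_app_iff, middle_In, in_map_iff; split.
  + intros [[i [<- Hi]]|[H _]]; [rewrite in_seq in Hi; apply core_In; lia|exact H].
  + intros Hf; destruct (F_cases f Hf) as [[i [Hi <-]]|H]; [left; exists i; rewrite in_seq; lia|auto].
Qed.

Lemma length_bounds : (m <= length F <= M)%nat.
Proof.
split.
- rewrite <- (length_seq m 0), <- (length_map core); apply NoDup_incl_length.
  + apply Injective_map_NoDup_in; [|apply seq_NoDup].
    intros i j Hi Hj; rewrite in_seq in Hi, Hj; apply core_injective; lia.
  + intros f Hf; apply in_map_iff in Hf; destruct Hf as [i [<- Hi]].
    rewrite in_seq in Hi; apply core_In; lia.
- rewrite <- (Permutation_length ordering_permutation); unfold ordering.
  rewrite length_app, length_map, length_seq.
  assert (L : (length (filter (fun f => andb (m <=? f) (f <? M)) F) <= M - m)%nat); [|lia].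
  rewrite <- (length_seq (M - m) m); apply NoDup_incl_length; [apply NoDup_filter, ND|].
  intros f Hf; apply middle_In in Hf; apply in_seq; lia.
Qed.

Lemma b_not_nat f i : In f F -> (i <= f)%nat -> b <> INR i.
Proof.
intros Hf Hi E; apply (F_ok f (f - i) Hf); rewrite minus_INR by auto; lra.
Qed.

Lemma b_gt f : In f F -> (M - 1 <= f)%nat -> INR M - 1 < b.
Proof.
intros Hf Hi; assert (Q := b_not_nat f (M - 1) Hf Hi).
rewrite minus_INR in Q by lia; simpl in Q; lra.
Qed.

(** Since 0 is not in F its partner N is, and [b_not_nat] then forbids b = M - 1. *)
Lemma b_gt_of_m : (0 < m)%nat -> INR M - 1 < b.
Proof.
intros m0; assert (n0 : ~ In 0%nat F) by (intros H; apply F_pos in H; lia).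
assert (C := core_In 0 m0); unfold core in C; destruct in_dec; [tauto|].
apply (b_gt _ C); unfold N; lia.
Qed.

(** Here a - b + 1 is the linear coefficient of Lam(f) = f (f + a - b + 1), so the vertex of this
    parabola is within 1/2 of N/2. *)
Lemma gamma_bounds : (0 < m)%nat -> - INR N - 1 < a - b + 1 < 1 - INR N.
Proof.
intros m0; assert (Q := b_gt_of_m m0); destruct a_up as [|]; [lia|].
unfold N; rewrite minus_INR, plus_INR by lia; simpl; lra.
Qed.

Lemma Lam_neq f g : f <> g -> Lam f <> Lam g.
Proof.
intros ne E; assert (D := eigenvalue_diff a (- b) f g); fold Lam in D.
rewrite E, Rminus_diag in D; symmetry in D; apply Rmult_integral in D.
destruct D as [D|D]; [apply ne, INR_eq; lra|].
apply (ab_ok (f + g)); rewrite S_INR, plus_INR; lra.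
Qed.

(** An f strictly between i and N - i is at least 1 away from both, which outweighs the displacement
    of the vertex from N/2. *)
Lemma Lam_core i f : (i < m)%nat -> (i < f < N - i)%nat -> Lam f < Lam (core i).
Proof.
intros Hi Hf; assert (G := gamma_bounds ltac:(lia)).
assert (D := eigenvalue_diff a (- b) (core i) f); fold Lam in D.
assert (i1 : (i + 1 <= f)%nat) by lia; assert (i2 : (f + i + 1 <= N)%nat) by lia.
apply le_INR in i1, i2; rewrite !plus_INR in i1; rewrite !plus_INR in i2; simpl in i1, i2.
assert (0 < Lam (core i) - Lam f); [|lra].
rewrite D; destruct (core_cases i) as [->| ->].
{ rewrite <- Rmult_opp_opp; apply Rmult_lt_0_compat; lra. }
rewrite minus_INR by lia; apply Rmult_lt_0_compat; lra.
Qed.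

Lemma core_inside i j : (i < j < m)%nat -> (i < core j < N - i)%nat.
Proof. intros H; destruct (core_cases j) as [->| ->]; unfold N; lia. Qed.

(** The two possible counts, i for i itself and m + (m - i) for N - i, have the same parity. *)
Lemma end_sign_core i : (i < m)%nat -> exists e, end_sign m M (core i) = (i + 2 * e)%nat.
Proof.
intros Hi; unfold end_sign; destruct (core_cases i) as [->| ->].
- exists 0%nat; lia.
- exists (m - i)%nat; unfold N; lia.
Qed.

Lemma end_product_F f : In f F -> 0 < (-1) ^ end_sign m M f *
  (ev (jacobiE a (- b) f) (-1) * ev (jacobiE a (- b) f) 1).
Proof.
intros Hf; apply end_product_sign; auto.
intros i Hi; apply (b_not_nat f); [auto|lia].
Qed.

(** For i < j both a + 1 + i and -b + 1 + i are negative, the latter because i + 1 <= M - 1 < b. The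
    j sign reversals then cancel the parity of [end_sign]. *)
Lemma core_chain_signs L j f e : admissible_chain a (- b) L -> length L = j ->
  (j <= m)%nat -> (j < M)%nat -> In f F -> end_sign m M f = (j + 2 * e)%nat -> ~ In f L ->
  0 < ev (chain a (- b) L f) (-1) * ev (chain a (- b) L f) 1.
Proof.
intros H EL jm jM Hf Ef ni.
assert (Q := chain_end_signs a (- b) L f H).
specialize (Q ltac:(intros g Hg; apply Lam_neq; intros ->; contradiction)).
rewrite EL in Q.
assert (pos : forall i, (i < j)%nat -> 0 < (a + 1 + INR i) * (- b + 1 + INR i)).
{ intros i Hi; assert (Q0 := b_gt_of_m ltac:(lia)).
  destruct a_up as [|am]; [lia|].
  assert (L1 : (i + 1 <= m)%nat) by lia; assert (L2 : (i + 1 + 1 <= M)%nat) by lia.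
  apply le_INR in L1, L2; rewrite !plus_INR in L1; rewrite !plus_INR in L2; simpl in L1, L2; nra. }
specialize (Q pos (end_sign m M f) (end_product_F f Hf)).
rewrite Ef in Q.
replace (j + 2 * e + j)%nat with (2 * (j + e))%nat in Q by lia.
rewrite pow_mult in Q; replace ((-1) ^ 2) with 1 in Q by ring.
rewrite pow1 in Q; lra.
Qed.

Definition core_list (j : nat) : list nat := rev (map core (seq 0 j)).

Lemma core_list_S j : core_list (S j) = core j :: core_list j.
Proof. unfold core_list; rewrite seq_S, map_app, rev_app_distr; reflexivity. Qed.

Lemma length_core_list j : length (core_list j) = j.
Proof. unfold core_list; rewrite length_rev, length_map, length_seq; auto. Qed.

Lemma core_list_In j f : In f (core_list j) -> exists i, (i < j)%nat /\ core i = f.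
Proof.
unfold core_list; rewrite <- in_rev, in_map_iff; intros [i [<- Hi]].
rewrite in_seq in Hi; exists i; split; [lia|auto].
Qed.

Lemma core_step j f e : (0 < j <= m)%nat -> (j < M)%nat ->
  admissible_chain a (- b) (core_list j) ->
  In f F -> (j - 1 < f < N - (j - 1))%nat -> end_sign m M f = (j + 2 * e)%nat ->
  ~ In f (core_list j) -> nonzero_on (chain a (- b) (core_list j) f).
Proof.
intros j0 jM H Hf inside Ef ni.
assert (S := core_chain_signs _ j f e H (length_core_list j) ltac:(lia) jM Hf Ef ni).
destruct j as [|j]; [lia|]; rewrite core_list_S in *.
apply chain_step_convex; auto.
apply Lam_core; simpl in inside; lia.
Qed.

Lemma core_admissible j : (j <= m)%nat -> admissible_chain a (- b) (core_list j).
Proof.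
induction j as [|j IH]; intros Hj; [exact I|].
specialize (IH ltac:(lia)); rewrite core_list_S; split; [|exact IH].
assert (ni : ~ In (core j) (core_list j)).
{ intros Q; apply core_list_In in Q; destruct Q as [i [Hi E]].
  apply core_injective in E; lia. }
destruct (end_sign_core j ltac:(lia)) as [e He].
destruct j as [|j].
(* The first element is N, as 0 is not in F, and [gamma_bounds] provides a - b + N < 0 for
   [jacobi_no_zero]. *)
- assert (S := core_chain_signs [] 0 (core 0) e I eq_refl ltac:(lia) ltac:(lia)
    (core_In 0 ltac:(lia)) He (fun H => H)).
  apply jacobi_no_zero; [|exact S].
  assert (n0 : ~ In 0%nat F) by (intros H; apply F_pos in H; lia).
  assert (G := gamma_bounds ltac:(lia)).
  unfold core; destruct in_dec; [tauto|]; rewrite Nat.sub_0_r; lra.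
- apply (core_step (S j) _ e); auto; try lia.
  + apply core_In; lia.
  + assert (Q := core_inside j (S j) ltac:(lia)); simpl; rewrite Nat.sub_0_r; exact Q.
Qed.

(** For m = 0 nothing has been transformed yet and [jacobi_positive] applies. Otherwise the m steps
    match [end_sign], which is m on [m, M-1]. *)
Lemma middle_nonzero f : In f F -> (m <= f < M)%nat ->
  nonzero_on (chain a (- b) (core_list m) f).
Proof.
intros Hf Hm; destruct (Nat.eq_dec m 0) as [m0|m0].
- rewrite m0; apply jacobi_positive; [rewrite m0 in a_low; simpl in a_low; lra|].
  assert (Q := b_not_nat f f Hf (le_n f)); assert (L : (f + 1 <= M)%nat) by lia.
  apply le_INR in L; rewrite plus_INR in L; simpl in L; lra.
- apply (core_step m f 0); auto; try lia.
  + apply core_admissible; lia.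
  + unfold end_sign; lia.
  + intros Q; apply core_list_In in Q; destruct Q as [i [Hi <-]].
    apply (core_outside i Hi); lia.
Qed.

Lemma ordering_admissible : admissible_chain a (- b) (rev ordering).
Proof.
unfold ordering; rewrite rev_app_distr; fold (core_list m); apply chain_extend.
- apply core_admissible; lia.
- intros f Hf; apply middle_In in Hf; apply middle_nonzero; tauto.
- apply NoDup_filter, ND.
- intros f g _ _ ne; apply Lam_neq, ne.
- rewrite length_core_list; lra.
Qed.

End Ordering.

(** * Conclusion for the sorted list *)

Lemma last_max F : StronglySorted lt F -> forall f, In f F -> (f <= last F 0)%nat.
Proof.
induction 1 as [|g F S IH A]; intros f Hf; [destruct Hf|].
destruct F as [|h F]; [destruct Hf as [->|[]]; auto|].
change (last (g :: h :: F) 0%nat) with (last (h :: F) 0%nat).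
destruct Hf as [->|Hf]; [|auto].
assert (Q := IH h (or_introl eq_refl)); inversion_clear A; lia.
Qed.

Lemma sorted_NoDup F : StronglySorted lt F -> NoDup F.
Proof.
induction 1 as [|g F S IH A]; constructor; auto.
intros H; rewrite Forall_forall in A; specialize (A g H); lia.
Qed.

Lemma positive_max_ge_length F : NoDup F -> F <> [] -> (forall f, In f F -> (0 < f)%nat) ->
  exists f, In f F /\ (length F <= f)%nat.
Proof.
intros ND ne pos; apply NNPP; intros H.
assert (L : (length F <= length (seq 1 (length F - 1)))%nat).
{ apply NoDup_incl_length; auto; intros f Hf; apply in_seq.
  assert (P := pos f Hf).
  destruct (le_lt_dec (length F) f); [exfalso; eauto|lia]. }
rewrite length_seq in L; destruct F; [auto|simpl in L; lia].
Qed.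

Theorem theorem6p6 (F2 : list nat) (a b : R) :
  valid_F2 F2 ->
  condA1 a b ->
  condA2 a b F2 ->
  jacobi_admissible a b F2 ->
  a + INR (length F2) + 1 > 0 /\
  b - INR (length F2) + 1 > 0 /\
  (forall x, -1 <= x <= 1 ->
     exists l, l <> 0 /\ limit1_in (OmegaRaw a b F2) (fun y => y <> -1) l x).
Proof.
intros [ne [sorted pos]] [ha [hb hs]] [hd hl] adm.
rewrite Forall_forall in pos.
assert (ND := sorted_NoDup F2 sorted).
(* (A2) mentions only the largest element; adding its distance to f carries the condition over to
   f. *)
assert (F_ok : forall f n, In f F2 -> INR n + b - INR f <> 0).
{ intros f n Hf; assert (L := last_max F2 sorted f Hf).
  assert (Q := hl (n + (last F2 0 - f))%nat).
  rewrite S_INR, plus_INR, minus_INR in Q by auto; lra. }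
assert (a_ok : forall n, INR n + a + 1 <> 0).
{ intros n; assert (Q := ha n); rewrite S_INR in Q; lra. }
assert (b_ok : forall n, INR n + b + 1 <> 0).
{ intros n; assert (Q := hb n); rewrite S_INR in Q; lra. }
assert (ab_ok : forall n, INR n + a + b + 1 <> 0).
{ intros n; assert (Q := hs n); rewrite S_INR in Q; lra. }
destruct (admissible_structure F2 a b a_ok b_ok ab_ok F_ok adm ND ne)
  as [m [M [b_cell [a_low [a_up [mM [M1 [paired bounded]]]]]]]].
assert (LB : (m <= length F2 <= M)%nat) by (eapply length_bounds; eauto).
destruct LB as [mk kM].
apply le_INR in mk, kM.
split; [lra|split].
(* An element f >= k excludes b = k - 1 by [b_not_nat], which makes b >= M - 1 >= k - 1 strict. *)
- destruct (positive_max_ge_length F2 ND ne pos) as [f [Hf Lf]].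
  assert (k1 : (1 <= length F2)%nat) by (destruct F2; [tauto|simpl; lia]).
  assert (Q : b <> INR (length F2 - 1)) by (eapply b_not_nat; eauto; lia).
  rewrite minus_INR in Q by auto; simpl in Q; lra.
- intros x Hx; apply wronskian_limit.
  apply (wronskian_nonzero a (- b) F2 (rev (ordering F2 m M))); auto.
  + eapply Permutation_trans; [apply Permutation_sym, Permutation_rev|].
    eapply ordering_permutation; eauto.
  + eapply ordering_admissible; eauto.
Qed.
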